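(* Let $a \bmod M$ be a congruence class with $\gcd(a,M)=1$ such that $-1$ is not a square in $\mathbb{F}_p$ for every prime $p\equiv a\pmod M$. Suppose that there are constants $C$ and $p_0$ such that for every prime $p\ge p_0$ with $p\equiv a\pmod M$ and every $f:P_3\to\mathbb{C}$, where $P_3=\{(\underline{x},\underline{x}\cdot\underline{x}):\underline{x}\in\mathbb{F}_p^2\}\subset\mathbb{F}_p^3$, $$\|(f\,d\sigma)^\vee\|_{L^3(\mathbb{F}_p^3)}\le C\,\|f\|_{L^2(P_3,d\sigma)}.$$ Then there is a constant $C'$ such that for every finite set $S\subset\mathbb{Z}^2$ and all complex coefficients $(a_n)_{n\in S}$, $$\Big\|\sum_{n\in S}a_n\,e^{2\pi i(n_1t_1+n_2t_2+(n_1^2+n_2^2)t_3)}\Big\|_{L^3(\mathbb{T}^3)}\le C'\Big(\sum_{n\in S}|a_n|^2\Big)^{1/2}.$$ Consequently the full integer paraboloid $\Gamma=\{(n_1,n_2,n_1^2+n_2^2):n_1,n_2\in\mathbb{Z}\}\subset\mathbb{Z}^3$ is a $\Lambda(3)$ set.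
   Context: For a prime $p$, $P_3\subset\mathbb{F}_p^3$ has $p^2$ points and carries the normalized counting measure $d\sigma$ (mass $p^{-2}$ per point), so $\|f\|_{L^2(P_3,d\sigma)}^2=p^{-2}\sum_{\xi\in P_3}|f(\xi)|^2$. The extension operator is $(f\,d\sigma)^\vee(x)=p^{-2}\sum_{\xi\in P_3}f(\xi)\,e_p(x\cdot\xi)$ for $x\in\mathbb{F}_p^3$, where $e_p(t)=e^{2\pi i t/p}$ and $\cdot$ is the standard dot product. $\mathbb{F}_p^3$ carries counting measure: $\|g\|_{L^3(\mathbb{F}_p^3)}^3=\sum_{x\in\mathbb{F}_p^3}|g(x)|^3$. $\mathbb{T}^3=(\mathbb{R}/\mathbb{Z})^3$ carries Lebesgue (Haar probability) measure. For $r>2$, a set $\Gamma\subset\mathbb{Z}^3$ is a $\Lambda(r)$ set if there is a constant $C'$ such that, for every $(a_\gamma)_{\gamma\in\Gamma}\in\ell^2(\Gamma)$, the Fourier series $\sum_{\gamma\in\Gamma}a_\gamma e^{2\pi i\gamma\cdot t}$ defines a function in $L^r(\mathbb{T}^3)$ with $L^r(\mathbb{T}^3)$ norm at most $C'\big(\sum_{\gamma\in\Gamma}|a_\gamma|^2\big)^{1/2}$. *)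

(* Defs.v *)
From HB Require Import structures.
From mathcomp Require Import all_boot all_order all_algebra finmap.
From mathcomp Require Import all_classical all_reals all_analysis.
From mathcomp Require Import complex.

Set Implicit Arguments.
Unset Strict Implicit.
Unset Printing Implicit Defensive.

Import Order.TTheory GRing.Theory Num.Theory.
Import numFieldNormedType.Exports.

Local Open Scope classical_set_scope.
Local Open Scope ring_scope.

(* The modulus of a complex number as an element of [R]; [`|z|] would live in
   [R[i]]. *)
Definition cabs {R : realType} (z : R[i]) : R := ComplexField.Normc.normc z.

(* [expi2pi x] is e^{2 pi i x}. *)
Definition expi2pi {R : realType} (x : R) : R[i] :=
  Complex (cos (2 * pi * x)) (sin (2 * pi * x)).

(** * Extension operator over F_p *)

(* [\val t] is the representative of [t] in {0, ..., p - 1} (p prime). *)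
Definition ep (R : realType) (p : nat) (t : 'F_p) : R[i] :=
  expi2pi ((\val t)%:R / p%:R).

Definition dotp (F : pzRingType) (n : nat) (x y : 'rV[F]_n) : F :=
  \sum_(i < n) x ord0 i * y ord0 i.

Definition P3 (p : nat) : {set 'rV['F_p]_3} :=
  [set (row_mx x (dotp x x)%:M : 'rV['F_p]_(2 + 1)) | x : 'rV['F_p]_2]%SET.

Definition P3_pt (p : nat) := {xi : 'rV['F_p]_3 | xi \in P3 p}.

Definition extension (R : realType) (p : nat) (f : P3_pt p -> R[i])
    (x : 'rV['F_p]_3) : R[i] :=
  (p%:R ^+ 2)^-1 * \sum_(xi : P3_pt p) f xi * ep R (dotp x (val xi)).

Definition L2norm_P3 (R : realType) (p : nat) (f : P3_pt p -> R[i]) : R :=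
  ((p%:R ^+ 2)^-1 * \sum_(xi : P3_pt p) cabs (f xi) ^+ 2) `^ 2^-1.

Definition L3norm_Fp3 (R : realType) (p : nat) (g : 'rV['F_p]_3 -> R[i]) : R :=
  (\sum_(x : 'rV['F_p]_3) cabs (g x) ^+ 3) `^ 3^-1.

(** * The torus and Lambda(r) sets *)

(* [R^3] with its Borel sigma-algebra.  A function on the torus (R/Z)^3 is
   represented by any function on R^3 with the same values on the unit cube
   [0, 1]^3, which carries the measure [haarT3] below. *)
Definition T3 (R : realType) :=
  (measurableTypeR R * measurableTypeR R * measurableTypeR R)%type.

Definition unif01 (R : realType) : probability (measurableTypeR R) R :=
  uniform_prob (@ltr01 R).

Definition haarT3 (R : realType) : {measure set (T3 R) -> \bar R} :=
  (unif01 R \x unif01 R \x unif01 R)%E.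

Definition LnormT3 (R : realType) (r : R) (F : T3 R -> R[i]) : \bar R :=
  ('N[haarT3 R]_(r%:E)[EFin \o cabs \o F])%E.

(* [R[i]] has no canonical sigma-algebra. *)
Definition cmeasurable (R : realType) (F : T3 R -> R[i]) : Prop :=
  measurable_fun setT (fun t => complex.Re (F t)) /\
  measurable_fun setT (fun t => complex.Im (F t)).

Definition character (R : realType) (g : int * int * int) (t : T3 R) : R[i] :=
  let: (g1, g2, g3) := g in let: (t1, t2, t3) := t in
  expi2pi (g1%:~R * t1 + g2%:~R * t2 + g3%:~R * t3).

Definition l2norm (R : realType) (I : choiceType) (a : I -> R[i]) : \bar R :=
  ((\esum_(i in [set: I]) (cabs (a i) ^+ 2)%:E) `^ 2^-1)%E.

Definition fourier_sum (R : realType) (G : set (int * int * int))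
    (a : G -> R[i]) (X : {fset G}) (t : T3 R) : R[i] :=
  \sum_(g <- X) a g * character (\val g) t.

(* [F] is the sum of the Fourier series with coefficients [a]: the partial sums
   over finite subsets of [G], directed by inclusion, converge to [F] in
   L^2(T^3). *)
Definition fourier_series_is (R : realType) (G : set (int * int * int))
    (a : G -> R[i]) (F : T3 R -> R[i]) : Prop :=
  forall e : R, 0 < e -> exists X0 : {fset G}, forall X : {fset G},
    (X0 `<=` X)%fset ->
    (LnormT3 2%R (fun t => F t - fourier_sum a X t)%R < e%:E)%E.

(* Membership of [F] in L^r is part of the last inequality, whose right-hand
   side is finite. *)
Definition Lambda_set (R : realType) (r : R) (G : set (int * int * int)) :
    Prop :=
  exists C' : R, forall a : G -> R[i], (l2norm a < +oo)%E ->
    exists F : T3 R -> R[i],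
      [/\ cmeasurable F, fourier_series_is a F &
          (LnormT3 r F <= C'%:E * l2norm a)%E].

Definition lift_paraboloid (n : int * int) : int * int * int :=
  (n.1, n.2, n.1 ^+ 2 + n.2 ^+ 2).

Definition integer_paraboloid : set (int * int * int) := range lift_paraboloid.

(* Main.v *)
(* For a prime [p] in the given class that is large compared with the frequencies
   of a trigonometric polynomial [T] on the lifted integer paraboloid, reduction
   mod [p] sends the coefficients of [T] to a function [f] on [P3 p] whose
   extension at [x] is [p^-2 T(x/p)].  The hypothesis at [p] therefore bounds the
   Riemann sum [p^-3 sum_x |T(x/p)|^3] by [(C |c|_2)^3], and [p -> oo] gives
   [|T|_3 <= C |c|_2].  The bound for Fourier series follows from Fatou's lemma
   along an almost everywhere convergent sequence of partial sums.

   Arbitrarily large primes in the class are supplied by Dirichlet's theorem, in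
   Shapiro's elementary form: for a nonprincipal character [chi], the sums
   [sum_(n <= N) chi(n) Lambda(n) / n] are bounded if [L(1, chi) <> 0] and equal
   [- ln N + O(1)] otherwise.  Summing over all characters, positivity leaves room
   for at most one vanishing [L(1, chi)], which must then be real; Monsky's
   Lambert series excludes that case. *)
Require Import Defs.
From mathcomp Require Import all_boot all_order all_algebra finmap.
From mathcomp Require Import all_fingroup all_solvable all_field all_character.
From mathcomp Require Import all_classical all_reals all_analysis.
From mathcomp Require Import measurable_realfun.
From mathcomp Require Import complex.
From mathcomp Require Import ring lra zify.

Import Order.TTheory GRing.Theory Num.Theory.
Import numFieldNormedType.Exports.
(* [character] must denote the character of the torus, not the predicate of
   character theory. *)
Import Defs.
Local Open Scope ring_scope.

Set Implicit Arguments.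
Unset Strict Implicit.

(** * Chebyshev and Mertens estimates *)

(** The exponent 3 is the one at which the transfer loses nothing: with the normalised measures the
    hypothesis at p reads p^-2 S^(1/3) <= C p^-1 |c|_2, where S is the sum of |T|^3 over the grid.
    Hence S <= p^3 (C |c|_2)^3, and p^3 is exactly the number of grid points. The constant [|C|]
    therefore serves for all frequencies; these only decide how large p has to be, once for
    reduction mod p to be injective and once for the Lipschitz error of the Riemann sum. The
    arithmetic stays at s = 1 and uses no complex analysis. The partial sums of L(1, chi) converge
    at rate O(1/N), and vanishing of L(1, chi) is always expressed as this rate with limit 0. For
    infinitely many coefficients the finite inequality is applied to differences of partial sums.
    The limit F is built pointwise from a rapidly convergent chain of finite sets, and convergence
    of the whole net of partial sums in L^2 is recovered from the L^3 estimates, because the torus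
    has mass one. *)

Section ComplexModulus.
Context {R : realType}.
Implicit Types (z w : R[i]) (x : R).

Lemma cabs_ge0 z : 0 <= cabs z.
Proof. by case: z => x y; rewrite /cabs /= sqrtr_ge0. Qed.

Lemma cabs0 : cabs (0 : R[i]) = 0.
Proof. exact: ComplexField.Normc.normc0. Qed.

Lemma cabs1 : cabs (1 : R[i]) = 1.
Proof. exact: ComplexField.Normc.normc1. Qed.

Lemma cabsM z w : cabs (z * w) = cabs z * cabs w.
Proof. exact: ComplexField.Normc.normcM. Qed.

Lemma cabsV z : cabs z^-1 = (cabs z)^-1.
Proof. exact: ComplexField.Normc.normcV. Qed.

Lemma cabsX z n : cabs (z ^+ n) = cabs z ^+ n.
Proof. by elim: n => [|n IH]; rewrite ?expr0 ?cabs1// !exprS cabsM IH. Qed.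

Lemma cabs_eq0 z : (cabs z == 0) = (z == 0).
Proof.
apply/eqP/eqP => [|->]; last exact: cabs0.
exact: ComplexField.Normc.eq0_normc.
Qed.

Lemma cabsN z : cabs (- z) = cabs z.
Proof. exact: normcN. Qed.

Lemma ler_cabsD z w : cabs (z + w) <= cabs z + cabs w.
Proof. exact: le_normcD. Qed.

Lemma cabsBC z w : cabs (z - w) = cabs (w - z).
Proof. by rewrite -cabsN opprB. Qed.

Lemma ler_cabsB z w : cabs (z - w) <= cabs z + cabs w.
Proof. by rewrite -(cabsN w) ler_cabsD. Qed.

Lemma lerB_cabs z w : cabs z - cabs w <= cabs (z - w).
Proof. by rewrite lerBlDr -{1}(subrK w z) ler_cabsD. Qed.

Lemma ler_cabs_sum (I : Type) (r : seq I) (P : pred I) (F : I -> R[i]) :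
  cabs (\sum_(i <- r | P i) F i) <= \sum_(i <- r | P i) cabs (F i).
Proof.
elim/big_ind2: _ => [|u z v w Hu Hv|//]; first by rewrite cabs0.
exact: le_trans (ler_cabsD _ _) (lerD Hu Hv).
Qed.

Lemma cabs_real x : cabs (x%:C)%C = `|x|.
Proof. by rewrite /cabs /= expr0n addr0 sqrtr_sqr. Qed.

Lemma cabs_sqr z : cabs z ^+ 2 = complex.Re z ^+ 2 + complex.Im z ^+ 2.
Proof. by case: z => x y; rewrite /cabs /= sqr_sqrtr// addr_ge0 ?sqr_ge0. Qed.

Lemma ler_Re_cabs z : `|complex.Re z| <= cabs z.
Proof.
rewrite -(@ler_pXn2r _ 2)// ?nnegrE ?cabs_ge0//.
by rewrite cabs_sqr real_normK ?num_real// lerDl sqr_ge0.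
Qed.

Lemma ler_Im_cabs z : `|complex.Im z| <= cabs z.
Proof.
rewrite -(@ler_pXn2r _ 2)// ?nnegrE ?cabs_ge0//.
by rewrite cabs_sqr real_normK ?num_real// lerDr sqr_ge0.
Qed.

Lemma cabs_nat n : cabs (n%:R : R[i]) = n%:R.
Proof. by rewrite -(rmorph_nat (real_complex R)) cabs_real normr_nat. Qed.

Lemma cabs_conj z : cabs (conjc z) = cabs z.
Proof. by case: z => x y; rewrite /cabs /= sqrrN. Qed.

End ComplexModulus.

Section VonMangoldt.
Context {R : realType}.

Lemma sum_multiples (V : nmodType) (G : nat -> V) d N : (0 < d)%N ->
  \sum_(1 <= n < N.+1 | (d %| n)%N) G (n %/ d)%N =
  \sum_(1 <= k < (N %/ d).+1) G k.
Proof.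
move=> d0; elim: N => [|N IH]; first by rewrite div0n !big_geq.
rewrite big_mkcond big_nat_recr// -big_mkcond IH.
have -> : (N.+1 %/ d = (d %| N.+1) + N %/ d)%N by rewrite divnS.
case: ifP => dN /=; last by rewrite add0n addr0.
by rewrite add1n [RHS]big_nat_recr//= dN.
Qed.

Lemma sum_divisors (V : nmodType) (G : nat -> V) n N : (0 < n <= N)%N ->
  \sum_(d <- divisors n) G d = \sum_(1 <= d < N.+1 | (d %| n)%N) G d.
Proof.
move=> /andP[n0 nN]; rewrite -[RHS]big_filter; apply: perm_big.
apply: uniq_perm; rewrite ?divisors_uniq ?filter_uniq ?iota_uniq// => d.
rewrite mem_filter mem_index_iota -dvdn_divisors//.
case dn: (d %| n)%N => //=.
by rewrite (dvdn_gt0 n0 dn) ltnS (leq_trans (dvdn_leq n0 dn) nN).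
Qed.

(** Both sides run over the pairs (d, k) with d k <= N, grouped by the product on the left and by d
    on the right; there is no splitting at the square root of N. The logarithm of the factorial, the
    twisted sums and the Lambert series are all rearranged in this way. *)
Lemma dirichlet_hyperbola (V : nmodType) (F : nat -> nat -> V) N :
  \sum_(1 <= n < N.+1) \sum_(d <- divisors n) F d (n %/ d)%N =
  \sum_(1 <= d < N.+1) \sum_(1 <= k < (N %/ d).+1) F d k.
Proof.
under eq_big_nat => n nN do rewrite (@sum_divisors _ _ n N)//.
rewrite (exchange_big_dep xpredT)//=.
by apply: eq_big_nat => d /andP[d0 _]; rewrite sum_multiples.
Qed.

Definition vonMangoldt (n : nat) : R :=
  \sum_(0 <= p < n.+1 | prime p) \sum_(1 <= k < n.+1)
    if (p ^ k == n)%N then ln p%:R else 0.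

Lemma ln_nat_ge0 n : 0 <= ln (n%:R : R).
Proof.
case: n => [|n]; first by rewrite ln0.
by rewrite ln_ge0// ler1n.
Qed.

Lemma vonMangoldt_ge0 n : 0 <= vonMangoldt n.
Proof.
apply: sumr_ge0 => p _; apply: sumr_ge0 => k _.
by case: ifP => // _; exact: ln_nat_ge0.
Qed.

(** A range common to all n <= N, so that the sums over n, p and k can be exchanged. Nothing is
    added, since p^k = n with k >= 1 forces p <= n and k <= n. *)
Lemma vonMangoldt_widen n N : (n <= N)%N ->
  vonMangoldt n = \sum_(0 <= p < N.+1 | prime p) \sum_(1 <= k < N.+1)
    if (p ^ k == n)%N then ln p%:R else 0.
Proof.
move=> nN; rewrite /vonMangoldt.
rewrite [RHS](@big_cat_nat _ _ _ n.+1)//= [X in _ = _ + X]big_nat_cond.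
rewrite [X in _ = _ + X]big1 ?addr0; last first.
  move=> p /andP[/andP[np _] pp]; apply: big1_seq => k /andP[_].
  rewrite mem_index_iota => /andP[k1 _].
  case: eqP => // pkn; move: np; rewrite ltnNge -{1}pkn.
  by rewrite -{1}(expn1 p) leq_exp2l ?prime_gt1// k1.
apply: eq_bigr => p pp.
rewrite [RHS](@big_cat_nat _ _ _ n.+1)//= [X in _ = _ + X]big_nat_cond.
rewrite [X in _ = _ + X]big1 ?addr0// => k /andP[/andP[nk _] _].
case: eqP => // pkn; move: nk; rewrite ltnNge -pkn.
by rewrite (ltnW (ltn_expl _ (prime_gt1 pp))).
Qed.

Lemma ln_factor n : (0 < n)%N ->
  ln n%:R = \sum_(0 <= p < n.+1 | prime p) (logn p n)%:R * ln p%:R :> R.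
Proof.
move=> n0; rewrite -{1}(partnT n0) /partn.
have H : forall r, {subset r <= index_iota 0 n.+1} ->
   ln (\prod_(p <- r | p \in predT) p ^ logn p n)%N%:R =
   \sum_(p <- r | prime p) (logn p n)%:R * ln p%:R :> R.
  elim=> [|p r IH] sr; first by rewrite !big_nil ln1.
  rewrite !big_cons/= natrM lnM ?posrE ?ltr0n; last 2 first.
  - by rewrite lognE; case: ifP => // /andP[pp _]; rewrite expn_gt0 prime_gt0.
  - apply: prodn_gt0 => q.
    by rewrite lognE; case: ifP => // /andP[pp _]; rewrite expn_gt0 prime_gt0.
  rewrite IH; last by move=> q qr; apply: sr; rewrite inE qr orbT.
  case: ifP => pp; last by rewrite lognE pp /= expn0 ln1 add0r.
  by rewrite natrX lnXn ?ltr0n ?prime_gt0// mulr_natl.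
by rewrite H.
Qed.

(** Each prime p contributes ln p once for every k >= 1 such that p^k divides n, hence [logn p n]
    times. *)
Lemma sum_divisors_vonMangoldt n : (0 < n)%N ->
  \sum_(d <- divisors n) vonMangoldt d = ln n%:R.
Proof.
move=> n0; rewrite (@sum_divisors _ _ n n) ?n0 ?leqnn//.
transitivity (\sum_(1 <= d < n.+1 | (d %| n)%N) \sum_(0 <= p < n.+1 | prime p)
   \sum_(1 <= k < n.+1) if (p ^ k == d)%N then ln p%:R else 0 : R).
  rewrite big_nat_cond [RHS]big_nat_cond.
  by apply: eq_bigr => d /andP[/andP[_ dn] _]; rewrite (@vonMangoldt_widen _ n).
rewrite exchange_big/= (ln_factor n0); apply: eq_bigr => p pp.
rewrite exchange_big/= logn_count_dvd// natr_sum mulr_suml.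
have p1 := prime_gt1 pp.
(* [logn_count_dvd] counts exponents k < n only; the exponent k = n contributes nothing because p^n
   > n. *)
rewrite big_nat_recr//= [X in _ + X]big1 ?addr0; last first.
  move=> d dn; case: eqP => // E; exfalso; move: (dvdn_leq n0 dn).
  by rewrite -E leqNgt ltn_expl.
apply: eq_big_nat => k /andP[k1 kn].
rewrite -big_mkcondr/=.
case pkn: (p ^ k %| n)%N; last first.
  rewrite mul0r big1// => d /andP[dn /eqP E].
  by rewrite -E pkn in dn.
rewrite mul1r (big_rem (p ^ k)%N)/= ?mem_index_iota; last first.
  by rewrite expn_gt0 prime_gt0//= ltnS (dvdn_leq n0 pkn).
rewrite pkn eqxx/= big_seq_cond big1 ?addr0// => d.
rewrite mem_rem_uniq ?iota_uniq// inE => /andP[/andP[/= dp _] /andP[_ /eqP E]].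
by rewrite E eqxx in dp.
Qed.


Lemma ln_succ_le n : (0 < n)%N -> ln (n.+1%:R : R) <= ln n%:R + n%:R^-1.
Proof.
move=> n0; have n0' : (0 : R) < n%:R by rewrite ltr0n.
have -> : n.+1%:R = n%:R * (1 + n%:R^-1) :> R.
  by rewrite mulrDr mulr1 divff ?gt_eqF// -natr1.
have iv : (0 : R) < n%:R^-1 by rewrite invr_gt0.
rewrite lnM ?posrE// ?lerD2l ?le_ln1Dx//; lra.
Qed.

Lemma ler_ln_nat m n : (m <= n)%N -> ln (m%:R : R) <= ln n%:R.
Proof.
case: m => [_|m mn]; first by rewrite ln0// ln_nat_ge0.
by rewrite ler_ln ?posrE ?ltr0n ?ler_nat//; apply: leq_trans mn.
Qed.

Lemma ln_factE N : ln (N`!%:R : R) = \sum_(1 <= n < N.+1) ln n%:R.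
Proof.
elim: N => [|N IH]; first by rewrite big_geq// fact0 ln1.
by rewrite big_nat_recr//= -IH factS natrM lnM ?posrE ?ltr0n ?fact_gt0// addrC.
Qed.

Lemma ln_fact_vonMangoldt N :
  ln (N`!%:R : R) = \sum_(1 <= d < N.+1) vonMangoldt d * (N %/ d)%:R.
Proof.
rewrite ln_factE; under eq_big_nat => n /andP[n0 _] do
  rewrite -sum_divisors_vonMangoldt//.
rewrite (dirichlet_hyperbola (fun d _ => vonMangoldt d)).
by apply: eq_bigr => d _; rewrite sumr_const_nat subn1 mulr_natr.
Qed.

Lemma ln_fact_ge N : N%:R * ln N%:R - N%:R <= ln (N`!%:R : R).
Proof.
elim: N => [|N IH]; first by rewrite mul0r subr0 fact0 ln1.
rewrite factS natrM lnM ?posrE ?ltr0n ?fact_gt0//.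
case: N IH => [|N] IH; first by rewrite ln1; move: IH; rewrite !mul1r fact0 ln1; lra.
have := @ln_succ_le N.+1 isT; rewrite -(natr1 N.+1).
have n0 : (0 : R) < N.+1%:R by rewrite ltr0n.
set l := ln (_ + 1); set l' := ln N.+1%:R in IH *.
move=> H; have : N.+1%:R * l <= N.+1%:R * l' + 1.
  apply: le_trans (_ : N.+1%:R * (l' + N.+1%:R^-1) <= _); first by rewrite ler_pM2l.
  by rewrite mulrDr divff ?gt_eqF.
by move: IH; lra.
Qed.

Definition chebyshev_psi N : R := \sum_(1 <= n < N.+1) vonMangoldt n.

Lemma chebyshev_psi_le m n : (m <= n)%N -> chebyshev_psi m <= chebyshev_psi n.
Proof.
move=> mn; rewrite /chebyshev_psi [leRHS](@big_cat_nat _ _ _ m.+1)//= lerDl.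
by apply: sumr_ge0 => i _; exact: vonMangoldt_ge0.
Qed.

(** Chebyshev's argument: ln C(2m, m) is the sum of Lambda(d) (floor(2m/d) - 2 floor(m/d)). These
    coefficients are non-negative, and equal to 1 for m < d <= 2m, while C(2m, m) <= 2^(2m). *)
Lemma chebyshev_psi_double m :
  chebyshev_psi m.*2 <= chebyshev_psi m + m.*2%:R * ln 2.
Proof.
have E : ln ('C(m.*2, m)%:R : R) = ln (m.*2)`!%:R - (ln m`!%:R) *+ 2.
  rewrite -(@bin_fact m.*2 m) -?addnn ?leq_addr// addnK !natrM.
  rewrite !lnM ?posrE ?mulr_gt0 ?ltr0n ?fact_gt0 ?bin_gt0 ?leq_addr//.
  by rewrite mulr2n addrK.
have B : ln ('C(m.*2, m)%:R : R) <= m.*2%:R * ln 2.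
  rewrite mulr_natl -lnXn// -natrX ler_ln ?posrE ?ltr0n ?bin_gt0 ?expn_gt0//;
    last by rewrite -addnn leq_addr.
  rewrite ler_nat -[2%N]/(1 + 1)%N expnDn.
  rewrite (bigD1 (inord m))//= !exp1n !muln1 inordK ?leq_addr//.
  by rewrite ltnS -addnn leq_addr.
suff: chebyshev_psi m.*2 - chebyshev_psi m <= ln ('C(m.*2, m)%:R : R).
  by move=> H; move: (le_trans H B); rewrite lerBlDl.
rewrite E !ln_fact_vonMangoldt.
have -> : \sum_(1 <= d < m.+1) vonMangoldt d * (m %/ d)%:R =
   \sum_(1 <= d < m.*2.+1) vonMangoldt d * (m %/ d)%:R.
  rewrite [RHS](@big_cat_nat _ _ _ m.+1)//= ?ltnS -?addnn ?leq_addr//.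
  rewrite [X in _ = _ + X]big_nat_cond.
  rewrite [X in _ = _ + X]big1 ?addr0// => d /andP[/andP[md _] _].
  by rewrite divn_small ?mulr0.
have -> : chebyshev_psi m =
    \sum_(1 <= d < m.*2.+1) vonMangoldt d * (d <= m)%N%:R.
  rewrite [RHS](@big_cat_nat _ _ _ m.+1)//= ?ltnS -?addnn ?leq_addr//.
  rewrite [X in _ = _ + X]big_nat_cond.
  rewrite [X in _ = _ + X]big1 ?addr0; last first.
    by move=> d /andP[/andP[md _] _]; rewrite leqNgt md mulr0.
  by apply: eq_big_nat => d /andP[_]; rewrite ltnS => ->; rewrite mulr1.
rewrite /chebyshev_psi -sumrMnl -!sumrB.
apply: ler_sum_nat => d /andP[d0 dm].
rewrite -mulrnAr -mulrBr -{1}(mulr1 (vonMangoldt d)) -mulrBr.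
apply: ler_wpM2l; first exact: vonMangoldt_ge0.
rewrite -mulrnA lerBlDr addrAC lerBrDr -natrD -[1]/(1%:R) -natrD ler_nat.
rewrite ltnS in dm; case: (leqP d m) => md /=.
  by rewrite add1n addn1 ltnS leq_divRL// mulnAC -muln2 leq_mul2r leq_divM.
by rewrite divn_small// mul0n !addn0 leq_divRL// mul1n.
Qed.

Lemma ln2_le1 : ln (2 : R) <= 1.
Proof. by have := @le_ln1Dx R 1; rewrite (_ : 1 + 1 = 2)//; apply; lra. Qed.

Lemma vonMangoldt1 : vonMangoldt 1 = 0.
Proof.
by rewrite -[LHS]addr0 -[RHS](@ln1 R) -(@sum_divisors_vonMangoldt 1)// big_seq1 addr0.
Qed.

Lemma chebyshev_psi_le4 N : chebyshev_psi N <= 4 * N%:R.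
Proof.
elim/ltn_ind: N => -[|[|N]] IH.
- by rewrite /chebyshev_psi big_geq// mulr0.
- by rewrite /chebyshev_psi big_nat1 vonMangoldt1 mulr_ge0.
(* Halving upwards keeps the argument n = N + 2 below 2m, and the resulting bound 4m + 2m is at most
   4n for every n >= 2. *)
pose m := uphalf N.+2.
have mN : (m < N.+2)%N by rewrite /m; lia.
have Nm : (N.+2 <= m.*2)%N by rewrite /m; lia.
have mN' : (m.*2 <= N.+3)%N by rewrite /m; lia.
apply: le_trans (chebyshev_psi_le Nm) _.
apply: le_trans (chebyshev_psi_double m) _.
have H2 : m.*2%:R * ln 2 <= m.*2%:R :> R.
  by rewrite -[leRHS]mulr1 ler_wpM2l// ln2_le1.
apply: le_trans (lerD (IH m mN) H2) _.
rewrite -natrM -natrD -natrM ler_nat; lia.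
Qed.

Lemma mertens_lower N : (0 < N)%N ->
  ln (N%:R : R) - 1 <= \sum_(1 <= d < N.+1) vonMangoldt d / d%:R.
Proof.
move=> N0; have N0' : (0 : R) < N%:R by rewrite ltr0n.
rewrite -(ler_pM2l N0') mulrBr mulr1 (le_trans (ln_fact_ge N))//.
rewrite ln_fact_vonMangoldt mulr_sumr.
apply: ler_sum_nat => d /andP[d0 _]; rewrite mulrCA.
apply: ler_wpM2l; first exact: vonMangoldt_ge0.
by rewrite ler_pdivlMr ?ltr0n// -natrM ler_nat leq_divM.
Qed.

Lemma ln_fact_le N : ln (N`!%:R : R) <= N%:R * ln N%:R.
Proof.
have -> : N%:R * ln N%:R = \sum_(1 <= n < N.+1) ln N%:R :> R.
  by rewrite sumr_const_nat subn1 mulr_natl.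
rewrite ln_factE.
by apply: ler_sum_nat => n /andP[_ nN]; apply: ler_ln_nat.
Qed.

(** Replacing floor(N/d) by N/d in the formula for ln N! costs at most psi(N) <= 4N, whence the
    constant 4. *)
Lemma mertens_upper N : (0 < N)%N ->
  \sum_(1 <= d < N.+1) vonMangoldt d / d%:R <= ln (N%:R : R) + 4.
Proof.
move=> N0; have N0' : (0 : R) < N%:R by rewrite ltr0n.
rewrite -(ler_pM2l N0') mulrDr.
apply: le_trans (lerD (ln_fact_le N) _); last first.
  by rewrite mulrC; exact: chebyshev_psi_le4.
rewrite ln_fact_vonMangoldt /chebyshev_psi -big_split/= mulr_sumr.
apply: ler_sum_nat => d /andP[d0 _]; rewrite mulrCA.
rewrite -[X in _ <= _ + X]mulr1 -mulrDr.
apply: ler_wpM2l; first exact: vonMangoldt_ge0.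
rewrite ler_pdivrMr ?ltr0n// natr1 -natrM ler_nat.
by apply: ltnW; apply: ltn_ceil.
Qed.

Lemma sum_ln_over_pronic N :
  \sum_(2 <= n < N.+1) ln (n%:R : R) / (n%:R * (n%:R - 1)) <= 2.
Proof.
(* A telescoping majorant modelled on (1 + ln x)/x, whose derivative is -ln x / x^2; the larger
   constant 2 absorbs the discretisation and gives the bound D 1 = 2. *)
pose D (n : nat) : R := (2 + ln n%:R) / n%:R.
have D0 n : (0 < n)%N -> 0 <= D n.
  by move=> n0; rewrite divr_ge0// addr_ge0// ln_nat_ge0.
have step m : (0 < m)%N ->
    ln (m.+1%:R : R) / (m.+1%:R * (m.+1%:R - 1)) <= D m - D m.+1.
  move=> m0; have m0' : (0 : R) < m%:R by rewrite ltr0n.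
  have m1' : (0 : R) < m.+1%:R by rewrite ltr0n.
  have E : (m.+1%:R : R) - 1 = m%:R by rewrite -natr1 addrK.
  rewrite E ler_pdivrMr ?mulr_gt0//.
  have -> : (D m - D m.+1) * (m.+1%:R * m%:R) =
     m.+1%:R * (2 + ln m%:R) - m%:R * (2 + ln m.+1%:R).
    by rewrite /D; field; rewrite !gt_eqF.
  have H := ln_succ_le m0.
  have H1 : m.+1%:R * ln m.+1%:R <= m.+1%:R * (ln m%:R + m%:R^-1) :> R.
    by rewrite ler_pM2l.
  have H2 : m.+1%:R * m%:R^-1 <= 2 :> R.
    by rewrite ler_pdivrMr// -natrM ler_nat; lia.
  move: H1 H2; rewrite mulrDr.
  rewrite -(natr1 m); set l := ln (m%:R + 1); set l' := ln _.
  lra.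
case: N => [|N]; first by rewrite big_geq.
suff : \sum_(2 <= n < N.+2) ln (n%:R : R) / (n%:R * (n%:R - 1)) <= D 1 - D N.+1.
  move/le_trans; apply; rewrite /D ln1 addr0 divr1 lerBlDr lerDl.
  exact: D0.
elim: N => [|N IH]; first by rewrite big_geq// subrr.
by rewrite big_nat_recr//= (le_trans (lerD IH (step _ _)))// addrA subrK.
Qed.

Lemma sum_prime_powers_le (p N : nat) : (1 < p)%N ->
  \sum_(2 <= k < N.+1) (p%:R ^+ k)^-1 <= (p%:R * (p%:R - 1))^-1 :> R.
Proof.
move=> p1; have p1' : (1 : R) < p%:R by rewrite ltr1n.
have p0 : (0 : R) < p%:R by rewrite (lt_trans _ p1').
have pm0 : (0 : R) < p%:R - 1 by rewrite subr_gt0.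
have X k : (0 : R) <= (p%:R ^+ k * (p%:R - 1))^-1.
  by rewrite invr_ge0 mulr_ge0 ?exprn_ge0 ?ltW.
case: N => [|N]; first by rewrite big_geq//; exact: (X 1%N).
suff -> : \sum_(2 <= k < N.+2) (p%:R ^+ k)^-1 =
    (p%:R * (p%:R - 1))^-1 - (p%:R ^+ N.+1 * (p%:R - 1))^-1 :> R.
  by rewrite lerBlDr lerDl.
elim: N => [|N IH]; first by rewrite big_geq// expr1 subrr.
rewrite big_nat_recr//= IH (exprS _ N.+1).
have : (p%:R : R) ^+ N.+1 != 0 by rewrite expf_neq0// gt_eqF.
move: (p%:R ^+ N.+1 : R) => y y0.
by field; rewrite y0 !gt_eqF.
Qed.

Lemma sum_nat_pick (F : nat -> R) (Q : pred nat) a m n :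
  \sum_(m <= i < n | Q i && (a == i)) F i =
  if (m <= a < n)%N && Q a then F a else 0.
Proof.
case: (boolP (a \in index_iota m n)) => an.
  rewrite (big_rem a)//= eqxx andbT big_seq_cond big1 ?addr0.
    by move: an; rewrite mem_index_iota => ->.
  move=> i; rewrite mem_rem_uniq ?iota_uniq// inE.
  by move=> /andP[/andP[/= ia _] /andP[_ /eqP E]]; rewrite E eqxx in ia.
move: (an); rewrite mem_index_iota => /negbTE -> /=.
by rewrite big_seq_cond big1// => i /andP[ii /andP[_ /eqP E]]; rewrite E ii in an.
Qed.

(** Proper prime powers contribute at most the sum of ln p / (p (p - 1)), whatever P is, and the
    primes satisfying P are at most B. Conversely, an unbounded sum forces primes satisfying P
    beyond every B, which is how primes are finally produced. *)
Lemma sum_vonMangoldt_bounded (P : pred nat) (B : nat) :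
  (forall p, prime p -> P p -> (p <= B)%N) ->
  forall N, \sum_(1 <= n < N.+1 | P n) vonMangoldt n / n%:R <=
    \sum_(1 <= p < B.+1) ln (p%:R : R) / p%:R + 2.
Proof.
move=> PB N.
have lnd (p n : nat) : 0 <= ln (p%:R : R) / n%:R by rewrite divr_ge0 ?ln_nat_ge0.
have -> : \sum_(1 <= n < N.+1 | P n) vonMangoldt n / n%:R =
   \sum_(0 <= p < N.+1 | prime p) \sum_(1 <= k < N.+1)
     \sum_(1 <= n < N.+1 | P n) if (p ^ k == n)%N then ln p%:R / n%:R else 0 :> R.
  under [RHS]eq_bigr do rewrite exchange_big/=.
  rewrite exchange_big/= big_nat_cond [RHS]big_nat_cond.
  apply: eq_bigr => n /andP[/andP[_ nN] _].
  rewrite (@vonMangoldt_widen n N)// mulr_suml; apply: eq_bigr => p pp.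
  by rewrite mulr_suml; apply: eq_bigr => k _; case: ifP; rewrite ?mul0r.
apply: (@le_trans _ _ (\sum_(0 <= p < N.+1 | prime p)
   ((if P p then ln p%:R / p%:R else 0) + ln p%:R / (p%:R * (p%:R - 1))))).
  rewrite big_nat_cond [leRHS]big_nat_cond.
  apply: ler_sum => p /andP[/andP[_ pN] pp].
  have p0 := prime_gt0 pp; have p1 := prime_gt1 pp.
  rewrite big_ltn//; last by rewrite (leq_trans _ pN)// ltnS.
  apply: lerD.
    rewrite -big_mkcondr/= expn1 sum_nat_pick.
    by rewrite p0 pN /=; case: ifP.
  apply: le_trans (_ : \sum_(2 <= k < N.+1) ln p%:R * (p%:R ^+ k)^-1 <= _).
    apply: ler_sum_nat => k /andP[k1 _].
    rewrite -big_mkcondr/= sum_nat_pick -natrX.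
    by case: ifP => // _; exact: lnd.
  rewrite -mulr_sumr ler_wpM2l ?ln_nat_ge0//.
  exact: sum_prime_powers_le.
rewrite big_split/=; apply: lerD; last first.
  apply: le_trans (sum_ln_over_pronic N).
  case: N => [|N]; first by rewrite big_mkcond big_nat1 /= big_geq.
  rewrite big_mkcond big_ltn// big_ltn//= !add0r.
  apply: ler_sum_nat => p /andP[p1 _]; case: ifP => // _.
  rewrite divr_ge0 ?ln_nat_ge0// mulr_ge0// subr_ge0 ler1n.
  exact: ltnW.
rewrite -big_mkcondr/= big_mkcond big_ltn//= add0r.
case: (leqP N B) => NB.
  rewrite [leRHS](@big_cat_nat _ _ _ N.+1)//= -[leLHS]addr0; apply: lerD.
    by apply: ler_sum_nat => p _; case: ifP.
  by apply: sumr_ge0 => p _.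
rewrite (@big_cat_nat _ _ _ B.+1)//=; last by rewrite ltnS ltnW.
rewrite -[leRHS]addr0; apply: lerD.
  by apply: ler_sum_nat => p _; case: ifP.
rewrite big_nat_cond big1// => p /andP[/andP[Bp _] _].
by case: ifP => // /andP[pp Pp]; move: Bp; rewrite ltnNge PB.
Qed.

End VonMangoldt.

(** * Sums of bounded characters *)

Section Moebius.
Context {R : realType}.

Definition moebius (n : nat) : R :=
  \prod_(p <- primes n) (if (logn p n == 1)%N then -1 else 0).

Lemma moebius1 : moebius 1 = 1.
Proof. by rewrite /moebius big_nil. Qed.

Lemma norm_moebius_le1 n : `|moebius n| <= 1.
Proof.
rewrite /moebius normr_prod.
suff : 0 <= \prod_(p <- primes n) `|if (logn p n == 1)%N then -1 else 0 : R| <= 1.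
  by case/andP.
elim/big_ind: _ => [|x y /andP[x0 x1] /andP[y0 y1]|p _]; rewrite ?ler01 ?lexx//.
  by rewrite mulr_ge0// mulr_ile1.
by case: ifP => _; rewrite ?normrN ?normr1 ?normr0 ler01 lexx.
Qed.

Lemma moebius_primeM p d : prime p -> (0 < d)%N ->
  moebius (p * d) = if (p %| d)%N then 0 else - moebius d.
Proof.
move=> pp d0; have p0 := prime_gt0 pp.
case: ifPn => pd.
  rewrite /moebius (big_rem p)/=; last first.
    by rewrite mem_primes pp muln_gt0 p0 d0 dvdn_mulr.
  have : (0 < logn p d)%N by rewrite logn_gt0 mem_primes pp d0.
  rewrite lognM// (logn_prime p pp) eqxx.
  by case: (logn p d) => //= k _; rewrite mul0r.
have P : perm_eq (primes (p * d)) (p :: primes d).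
  apply: uniq_perm; first exact: primes_uniq.
    by rewrite /= primes_uniq mem_primes (negbTE pd) !andbF.
  by move=> q; rewrite primesM// primes_prime// !inE.
rewrite /moebius (perm_big _ P)/= big_cons lognM// logn_prime// eqxx.
rewrite (_ : logn p d = 0%N) ?addn0 ?eqxx ?mulN1r; last first.
  by apply/eqP; rewrite -leqn0 leqNgt logn_gt0 mem_primes (negbTE pd) !andbF.
congr (- _); apply: eq_big_seq => q; rewrite mem_primes => /and3P[qp _ qd].
rewrite lognM// (logn_prime q pp); case: (q =P p) => [E|]; last by rewrite add0n.
by move: pd; rewrite -E qd.
Qed.

(** With p the least prime factor of n, the divisors not divisible by p cancel against their
    multiples by p; divisors divisible by p^2 contribute 0. *)
Lemma sum_divisors_moebius n : (0 < n)%N ->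
  \sum_(d <- divisors n) moebius d = (n == 1)%N%:R.
Proof.
move=> n0; case: eqVneq => [->|n1].
  by rewrite big_seq1 moebius1.
have {n1} n1 : (1 < n)%N by rewrite ltn_neqAle eq_sym n1.
pose p := pdiv n; have pp : prime p by exact: pdiv_prime.
have p0 := prime_gt0 pp.
have pn : (p %| n)%N by exact: pdiv_dvd.
have E : (n = p * (n %/ p))%N by rewrite mulnC divnK.
have n'0 : (0 < n %/ p)%N by rewrite divn_gt0// dvdn_leq.
rewrite (@sum_divisors _ _ n n) ?n0 ?leqnn//.
rewrite (bigID (fun d => p %| d)%N)/=.
pose G k := if (p * k %| n)%N then moebius (p * k) else 0.
have -> : \sum_(1 <= i < n.+1 | (i %| n)%N && (p %| i)%N) moebius i =
    \sum_(1 <= i < n.+1 | (p %| i)%N) G (i %/ p)%N.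
  rewrite big_mkcondl/=; apply: eq_bigr => i pi.
  by rewrite /G (mulnC p) divnK.
rewrite sum_multiples// -[X in _ = X](subrr (\sum_(d <- divisors (n %/ p) | ~~ (p %| d)%N) moebius d)).
rewrite addrC; congr (_ + _).
  rewrite [RHS]big_mkcond (@sum_divisors _ _ (n %/ p) n) ?n'0 ?leq_div//.
  rewrite -big_mkcondr/=; apply: eq_bigl => d.
  case pd : (p %| d)%N; rewrite ?andbF ?andbT//=.
  by rewrite [in LHS]E Gauss_dvdr// coprime_sym prime_coprime// pd.
rewrite [X in - X]big_mkcond (@sum_divisors _ _ (n %/ p) (n %/ p)) ?n'0 ?leqnn//.
rewrite -sumrN [RHS]big_mkcond/= big_nat_cond [RHS]big_nat_cond.
apply: eq_bigr => k /andP[/andP[k0 _] _].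
rewrite /G [in LHS]E dvdn_pmul2l// moebius_primeM//.
by case: ifP => // _; case: ifP => _; rewrite ?oppr0.
Qed.

(** Write ln d = ln n - ln (n/d). The first part vanishes, as the divisor sum of the Moebius
    function is supported at 1, where ln is 0; the second is the Moebius inversion of
    [sum_divisors_vonMangoldt]. *)
Lemma sum_divisors_moebius_ln n : (0 < n)%N ->
  \sum_(d <- divisors n) moebius d * ln d%:R = - vonMangoldt n :> R.
Proof.
move=> n0.
have -> : \sum_(d <- divisors n) moebius d * ln d%:R =
   \sum_(d <- divisors n) moebius d * ln n%:R -
   \sum_(d <- divisors n) moebius d * ln (n %/ d)%:R.
  rewrite -sumrB; apply: eq_big_seq => d; rewrite -dvdn_divisors// => dn.
  rewrite -mulrBr; congr (_ * _).
  have d0 : (0 < d)%N := dvdn_gt0 n0 dn.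
  rewrite -{1}(divnK dn) natrM lnM ?posrE ?ltr0n//; last first.
    by rewrite divn_gt0// dvdn_leq.
  by rewrite addrAC subrr add0r.
rewrite -mulr_suml sum_divisors_moebius//.
rewrite (_ : _%:R * _ = 0) ?sub0r; last first.
  by case: eqP => [->|]; rewrite ?ln1 ?mulr0 ?mul0r.
congr (- _).
transitivity (\sum_(1 <= d < n.+1 | (d %| n)%N)
    \sum_(1 <= e < n.+1 | (e %| n %/ d)%N) moebius d * vonMangoldt e).
  rewrite (@sum_divisors _ _ n n) ?n0 ?leqnn//.
  apply: eq_bigr => d dn.
  rewrite -mulr_sumr -sum_divisors ?sum_divisors_vonMangoldt//.
    by rewrite (divn_gt0 _ (dvdn_gt0 n0 dn)) dvdn_leq.
  by rewrite leq_div andbT (divn_gt0 _ (dvdn_gt0 n0 dn)) dvdn_leq.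
rewrite (exchange_big_dep (fun e => e %| n)%N)/=; last first.
  move=> d e dn /dvdn_trans; apply; exact: dvdn_div.
transitivity (\sum_(1 <= e < n.+1 | (e %| n)%N) (n %/ e == 1)%N%:R * vonMangoldt e : R).
  apply: eq_bigr => e en.
  have e0 := dvdn_gt0 n0 en.
  have ne0 : (0 < n %/ e)%N by rewrite divn_gt0// dvdn_leq.
  rewrite -sum_divisors_moebius// mulr_suml.
  rewrite (@sum_divisors _ _ (n %/ e) n) ?leq_div ?ne0//.
  rewrite big_nat_cond [RHS]big_nat_cond; apply: eq_bigl => d.
  case: (boolP (0 < d < n.+1)%N) => //= /andP[d0 _].
  case dn : (d %| n)%N => /=.
    by rewrite dvdn_divRL// dvdn_divRL// mulnC.
  case: (boolP (d %| n %/ e)%N) => // /dvdn_trans /(_ (dvdn_div en)).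
  by rewrite dn.
rewrite (big_rem n)/= ?mem_index_iota ?n0 ?ltnSn//.
rewrite dvdnn divnn n0 eqxx mul1r big_seq_cond big1 ?addr0// => e.
rewrite mem_rem_uniq ?iota_uniq// inE => /andP[/andP[/= ne _] en].
case: eqP => [E|]; last by rewrite mul0r.
by move: ne; rewrite -(divnK en) E mul1n eqxx.
Qed.

End Moebius.

(** * Limits with explicit rates and summation by parts *)

Section RealCauchy.
Context {R : realType}.

(** The intervals of centre [a n] and radius [e n] meet pairwise, so the supremum of their left ends
    lies in all of them. This keeps the rate in the limit. *)
Lemma real_cauchy_rate (a e : nat -> R) :
  (forall n m, `|a n - a m| <= e n + e m) ->
  exists L, forall n, `|a n - L| <= e n.
Proof.
move=> H; pose E : set R := range (fun n => a n - e n).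
have U m : ubound E (a m + e m).
  move=> _ [n _ <-]; have := H n m; rewrite ler_norml => /andP[_]; lra.
have hs : has_sup E by split; [exists (a 0%N - e 0%N), 0%N | exists (a 0%N + e 0%N); exact: U].
exists (sup E) => n; rewrite ler_norml.
have H1 : a n - e n <= sup E by apply: ub_le_sup; [case: hs|exists n].
have H2 : sup E <= a n + e n by apply: ge_sup; [case: hs|exact: U].
by apply/andP; split; lra.
Qed.

Lemma complex_cauchy_rate (u : nat -> R[i]) (e : nat -> R) :
  (forall n m, cabs (u n - u m) <= e n + e m) ->
  exists L, forall n, cabs (u n - L) <= 2 * e n.
Proof.
move=> H.
have [x Hx] : exists L, forall n, `|complex.Re (u n) - L| <= e n.
  apply: real_cauchy_rate => n m; apply: le_trans (H n m).
  by apply: le_trans (ler_Re_cabs _); case: (u n) => ? ?; case: (u m).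
have [y Hy] : exists L, forall n, `|complex.Im (u n) - L| <= e n.
  apply: real_cauchy_rate => n m; apply: le_trans (H n m).
  by apply: le_trans (ler_Im_cabs _); case: (u n) => ? ?; case: (u m).
exists (Complex x y) => n; move: (Hx n) (Hy n); case: (u n) => a b /= Ha Hb.
have e0 := le_trans (normr_ge0 _) Ha.
rewrite -[leLHS]/(cabs (Complex (a - x) (b - y))).
rewrite -(@ler_pXn2r _ 2)// ?nnegrE ?cabs_ge0 ?mulr_ge0//.
rewrite cabs_sqr/= exprMn.
have Ha2 : (a - x) ^+ 2 <= e n ^+ 2 by rewrite -real_normK ?num_real// lerXn2r ?nnegrE.
have Hb2 : (b - y) ^+ 2 <= e n ^+ 2 by rewrite -real_normK ?num_real// lerXn2r ?nnegrE.
have := sqr_ge0 (e n); lra.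
Qed.

End RealCauchy.

Section AbelSummation.
Context {R : realType}.

(** After summation by parts the non-negative weights [h n - h n.+1] and the last value of [h] add
    up to exactly [h m]. *)
Lemma abel_summation_bound (g : nat -> R[i]) (h : nat -> R) (m : nat) (B : R) :
  (forall N, cabs (\sum_(m <= i < N) g i) <= B) ->
  (forall n, (m <= n)%N -> 0 <= h n.+1 <= h n) ->
  forall N, cabs (\sum_(m <= n < N) g n * (h n)%:C%C) <= B * h m.
Proof.
move=> gB hd N.
have B0 : 0 <= B by apply: le_trans (gB 0%N); exact: cabs_ge0.
have h0 n : (m <= n)%N -> 0 <= h n.
  by move=> mn; have /andP[h1 h2] := hd n mn; apply: le_trans h2.
have [Nm|] := leqP N m.
  by rewrite big_geq// cabs0 mulr_ge0 ?h0.
move=> mN; pose s n := \sum_(m <= i < n) g i.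
have E : forall k, \sum_(m <= n < m + k) g n * (h n)%:C%C =
   s (m + k)%N * (h (m + k)%N)%:C%C +
   \sum_(m <= n < m + k) s n.+1 * (h n - h n.+1)%:C%C.
  elim=> [|k IH]; first by rewrite addn0 /s !big_geq// mul0r addr0.
  rewrite addnS big_nat_recr ?leq_addr//= IH [in RHS]big_nat_recr ?leq_addr//=.
  rewrite /s big_nat_recr ?leq_addr//= rmorphB/=.
  by ring.
have F : forall k, \sum_(m <= n < m + k) (h n - h n.+1) = h m - h (m + k)%N.
  elim=> [|k IH]; first by rewrite addn0 big_geq// subrr.
  by rewrite addnS big_nat_recr ?leq_addr//= IH addrA subrK.
rewrite -(subnKC (ltnW mN)) E; set k := (N - m)%N.
apply: le_trans (ler_cabsD _ _) _.
apply: le_trans (_ : B * h (m + k)%N + \sum_(m <= n < m + k) B * (h n - h n.+1) <= _).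
  apply: lerD.
    by rewrite cabsM cabs_real ger0_norm ?h0 ?leq_addr// ler_wpM2r ?h0 ?leq_addr// gB.
  apply: le_trans (ler_cabs_sum _ _ _) _; apply: ler_sum_nat => n /andP[mn _].
  have /andP[h1 h2] := hd n mn.
  by rewrite cabsM cabs_real ger0_norm ?subr_ge0// ler_wpM2r ?subr_ge0// gB.
by rewrite -mulr_sumr F -mulrDr addrC subrK.
Qed.

End AbelSummation.

Section BoundedPartialSums.
Context {R : realType}.
Variables (chi : nat -> R[i]) (A : R).
Hypothesis chiM : forall m n, chi (m * n) = chi m * chi n.
Hypothesis chi1 : chi 1%N = 1.
Hypothesis chi_le1 : forall n, cabs (chi n) <= 1.
Hypothesis chi_sum : forall N, cabs (\sum_(1 <= n < N.+1) chi n) <= A.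

Let A0 : 0 <= A.
Proof. by apply: le_trans (chi_sum 0); exact: cabs_ge0. Qed.

Lemma chi_interval m N : (0 < m)%N -> cabs (\sum_(m <= n < N) chi n) <= 2 * A.
Proof.
case: m => // m _; case: N => [|N]; first by rewrite big_geq// cabs0 mulr_ge0.
have [Nm|mN] := leqP N m; first by rewrite big_geq// cabs0 mulr_ge0.
have -> : \sum_(m.+1 <= n < N.+1) chi n =
    \sum_(1 <= n < N.+1) chi n - \sum_(1 <= n < m.+1) chi n.
  by rewrite [X in X - _](@big_cat_nat _ _ _ m.+1)//= 1?ltnW// addrAC subrr add0r.
by apply: le_trans (ler_cabsB _ _) _; rewrite mulr2n mulrDl mul1r lerD.
Qed.

Lemma chi_abel (h : nat -> R) m N : (0 < m)%N ->
  (forall n, (m <= n)%N -> 0 <= h n.+1 <= h n) ->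
  cabs (\sum_(m <= n < N) chi n * (h n)%:C%C) <= 2 * A * h m.
Proof.
by move=> m0 hd; apply: abel_summation_bound => // K; exact: chi_interval.
Qed.

(** The partial sums of L(1, chi). *)
Definition chi_over_n N : R[i] := \sum_(1 <= n < N.+1) chi n * (n%:R^-1)%:C%C.

Lemma inv_decr n : (0 < n)%N -> 0 <= (n.+1%:R^-1 : R) <= n%:R^-1.
Proof.
by move=> n0; rewrite invr_ge0 ler0n/= lef_pV2 ?posrE ?ltr0n// ler_nat.
Qed.

Lemma chi_over_n_diff m N : (m <= N)%N ->
  cabs (chi_over_n N - chi_over_n m) <= 2 * A / m.+1%:R.
Proof.
move=> mN; rewrite /chi_over_n [X in X - _](@big_cat_nat _ _ _ m.+1)//=.
rewrite addrAC subrr add0r; apply: chi_abel => // n mn.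
by apply: inv_decr; apply: leq_trans mn.
Qed.

Lemma chi_over_n_cvg : exists L : R[i],
  forall N, cabs (chi_over_n N - L) <= 4 * A / N.+1%:R.
Proof.
have [L HL] : exists L : R[i],
    forall N, cabs (chi_over_n N - L) <= 2 * (2 * A / N.+1%:R).
  apply: complex_cauchy_rate => n m.
  have p k : 0 <= 2 * A / k.+1%:R by rewrite divr_ge0// mulr_ge0.
  have [/chi_over_n_diff H|/ltnW/chi_over_n_diff H] := leqP m n.
    by apply: le_trans H _; rewrite lerDr.
  by rewrite cabsBC; apply: le_trans H _; rewrite lerDl.
by exists L => N; apply: le_trans (HL N) _; rewrite !mulrA -natrM.
Qed.

(** ln n / n increases at first, whereas (1 + ln n)/n decreases from n = 1 on. Summation by parts is
    applied to the latter and to 1/n, each costing 2A. *)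
Lemma chi_ln_over_n_bounded N :
  cabs (\sum_(1 <= n < N.+1) chi n * (ln n%:R / n%:R)%:C%C) <= 4 * A.
Proof.
have -> : \sum_(1 <= n < N.+1) chi n * (ln n%:R / n%:R)%:C%C =
  \sum_(1 <= n < N.+1) chi n * ((1 + ln n%:R) / n%:R)%:C%C - chi_over_n N.
  rewrite /chi_over_n -sumrB; apply: eq_bigr => n _.
  by rewrite -mulrBr -rmorphB/= mulrDl mul1r addrAC subrr add0r.
apply: le_trans (ler_cabsB _ _) _.
have -> : 4 * A = 2 * A + 2 * A by rewrite -mulrDl -natrD.
apply: lerD.
  have -> : 2 * A = 2 * A * ((1 + ln 1%:R) / 1%:R) by rewrite ln1 addr0 divr1 mulr1.
  apply: chi_abel => // n n0; apply/andP; split.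
    by rewrite divr_ge0// addr_ge0// ln_nat_ge0.
  have n0' : (0 : R) < n%:R by rewrite ltr0n.
  rewrite ler_pdivrMr ?ltr0n// mulrAC ler_pdivlMr//.
  have := ln_succ_le (R := R) n0; have := ln_nat_ge0 (R := R) n.
  rewrite -(natr1 n); set l := ln _; set l' := ln _ => l0 H.
  have : l' * n%:R <= (l + n%:R^-1) * n%:R by rewrite ler_pM2r.
  rewrite mulrDl mulVf ?gt_eqF//; lra.
have -> : 2 * A = 2 * A * 1%:R^-1 by rewrite invr1 mulr1.
by apply: chi_abel => // n n0; exact: inv_decr.
Qed.

Definition chi_vonMangoldt N : R[i] :=
  \sum_(1 <= n < N.+1) chi n * (vonMangoldt n / n%:R)%:C%C.

Lemma floor_succ_inv_le (N d : nat) : (0 < d)%N -> (0 < N)%N ->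
  ((N %/ d).+1%:R)^-1 <= d%:R / N%:R :> R.
Proof.
move=> d0 N0; rewrite ler_pdivlMr ?ltr0n// mulrC ler_pdivrMr ?ltr0n//.
by rewrite -natrM ler_nat mulnC ltnW// ltn_ceil.
Qed.

(** Since ln is the divisor sum of Lambda, the sum of chi(n) ln n / n equals the sum over d of
    chi(d) Lambda(d) / d times the partial sum of L(1, chi) up to N/d. Replacing that partial sum by
    L costs at most 4A d/N, in total 4A psi(N)/N <= 16A; the left side accounts for the other 4A. *)
Lemma chi_vonMangoldt_bounded (L : R[i]) : L != 0 ->
  (forall N, cabs (chi_over_n N - L) <= 4 * A / N.+1%:R) ->
  exists K, forall N, cabs (chi_vonMangoldt N) <= K.
Proof.
move=> L0 HL; exists ((4 * A + 16 * A) / cabs L) => N.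
have cL : 0 < cabs L by rewrite lt_def cabs_ge0 cabs_eq0 L0.
case: (posnP N) => [->|N0].
  rewrite /chi_vonMangoldt big_geq// cabs0 divr_ge0 ?cabs_ge0// -mulrDl.
  by rewrite mulr_ge0.
have N0' : (0 : R) < N%:R by rewrite ltr0n.
rewrite ler_pdivlMr// -cabsM.
have E : \sum_(1 <= n < N.+1) chi n * (ln n%:R / n%:R)%:C%C =
   chi_vonMangoldt N * L +
   \sum_(1 <= d < N.+1) chi d * (vonMangoldt d / d%:R)%:C%C *
      (chi_over_n (N %/ d) - L).
  rewrite /chi_vonMangoldt mulr_suml -big_split/=.
  under [RHS]eq_bigr do rewrite -mulrDr addrC subrK /chi_over_n mulr_sumr.
  rewrite -(dirichlet_hyperbola (fun d k => chi d * (vonMangoldt d / d%:R)%:C%C *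
    (chi k * (k%:R^-1)%:C%C))).
  apply: eq_big_nat => n /andP[n0 _].
  rewrite -sum_divisors_vonMangoldt// mulr_suml rmorph_sum/= mulr_sumr.
  apply: eq_big_seq => d; rewrite -dvdn_divisors// => dn.
  rewrite mulrACA -chiM (mulnC d) divnK// -rmorphM/=; congr (_ * (_)%:C%C).
  by rewrite -mulrA -invfM -natrM mulnC divnK.
have -> : chi_vonMangoldt N * L = \sum_(1 <= n < N.+1) chi n * (ln n%:R / n%:R)%:C%C
   - \sum_(1 <= d < N.+1) chi d * (vonMangoldt d / d%:R)%:C%C *
      (chi_over_n (N %/ d) - L) by rewrite E addrK.
apply: le_trans (ler_cabsB _ _) _; apply: lerD; first exact: chi_ln_over_n_bounded.
apply: le_trans (ler_cabs_sum _ _ _) _.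
apply: (@le_trans _ _ (\sum_(1 <= d < N.+1) vonMangoldt d * (4 * A / N%:R))).
  apply: ler_sum_nat => d /andP[d0 _].
  have d0' : (0 : R) < d%:R by rewrite ltr0n.
  have v0 : 0 <= vonMangoldt d / d%:R :> R by rewrite divr_ge0 ?vonMangoldt_ge0.
  rewrite !cabsM cabs_real ger0_norm//.
  apply: (@le_trans _ _ (1 * (vonMangoldt d / d%:R) * (4 * A * (d%:R / N%:R)))).
    apply: ler_pM; [by rewrite mulr_ge0 ?cabs_ge0|exact: cabs_ge0|
      by rewrite ler_wpM2r|].
    apply: le_trans (HL _) _; rewrite ler_wpM2l ?mulr_ge0//.
    exact: floor_succ_inv_le.
  by rewrite le_eqVlt; apply/orP; left; apply/eqP; field; rewrite !gt_eqF.
rewrite -mulr_suml; apply: le_trans (_ : 4 * N%:R * (4 * A / N%:R) <= _).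
  rewrite ler_wpM2r ?divr_ge0 ?mulr_ge0 ?ler0n//.
  exact: chebyshev_psi_le4.
by rewrite le_eqVlt; apply/orP; left; apply/eqP; field; rewrite gt_eqF.
Qed.

(** The weights mu(d) (ln N - ln d) have divisor sum Lambda(n), plus ln N at n = 1. Hence the
    quantity to bound is a combination of partial sums of L(1, chi), which are small by assumption,
    and the total error 4A/N times N ln N - ln N! is at most 4A by [ln_fact_ge]. *)
Lemma chi_vonMangoldt_zero :
  (forall N, cabs (chi_over_n N) <= 4 * A / N.+1%:R) ->
  forall N, (0 < N)%N -> cabs (chi_vonMangoldt N + (ln N%:R)%:C%C) <= 4 * A.
Proof.
move=> H N N0.
have N0' : (0 : R) < N%:R by rewrite ltr0n.
have -> : chi_vonMangoldt N + (ln N%:R)%:C%C =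
  \sum_(1 <= d < N.+1) chi d * (moebius d * (ln N%:R - ln d%:R) / d%:R)%:C%C *
    chi_over_n (N %/ d).
  under [RHS]eq_bigr do rewrite mulr_sumr.
  rewrite -(dirichlet_hyperbola (fun d k =>
    chi d * (moebius d * (ln N%:R - ln d%:R) / d%:R)%:C%C *
    (chi k * (k%:R^-1)%:C%C))).
  have -> : (ln N%:R)%:C%C = \sum_(1 <= n < N.+1)
      chi n * (ln N%:R * (n == 1)%N%:R / n%:R)%:C%C :> R[i].
    rewrite big_ltn// eqxx mulr1 divr1 chi1 mul1r big_nat_cond big1 ?addr0//.
    by move=> n /andP[/andP[n1 _] _]; rewrite gtn_eqF// mulr0 mul0r mulr0.
  rewrite /chi_vonMangoldt -big_split/=.
  apply: eq_big_nat => n /andP[n0 _].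
  have -> : \sum_(d <- divisors n)
      chi d * (moebius d * (ln N%:R - ln d%:R) / d%:R)%:C%C *
      (chi (n %/ d)%N * ((n %/ d)%N%:R^-1)%:C%C) =
    \sum_(d <- divisors n) chi n * (moebius d * (ln N%:R - ln d%:R) / n%:R)%:C%C.
    apply: eq_big_seq => d; rewrite -dvdn_divisors// => dn.
    rewrite mulrACA -chiM (mulnC d) divnK// -rmorphM/=; congr (_ * (_)%:C%C).
    by rewrite -[LHS]mulrA -invfM -natrM mulnC divnK.
  rewrite -mulr_sumr -rmorph_sum/= -mulr_suml -mulrDr -rmorphD/= -mulrDl.
  congr (_ * (_ / _)%:C%C); rewrite -sum_divisors_moebius// mulr_sumr.
  have := sum_divisors_moebius_ln (R := R) n0; move/(congr1 -%R); rewrite opprK => <-.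
  by rewrite addrC -sumrB; apply: eq_bigr => d _; rewrite mulrBr (mulrC (ln _)).
apply: le_trans (ler_cabs_sum _ _ _) _.
apply: (@le_trans _ _ (\sum_(1 <= d < N.+1) (ln N%:R - ln d%:R) * (4 * A / N%:R))).
  apply: ler_sum_nat => d /andP[d0]; rewrite ltnS => dN.
  have d0' : (0 : R) < d%:R by rewrite ltr0n.
  have l0 : 0 <= ln N%:R - ln d%:R :> R by rewrite subr_ge0 ler_ln_nat.
  rewrite !cabsM cabs_real !normrM (ger0_norm l0) normfV normr_nat.
  apply: (@le_trans _ _ (1 * (1 * (ln N%:R - ln d%:R) / d%:R) * (4 * A * (d%:R / N%:R)))).
    have P : 0 <= `|moebius d| * (ln N%:R - ln d%:R) / d%:R :> R.
      by rewrite mulr_ge0 ?mulr_ge0 ?invr_ge0.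
    apply: ler_pM; [by rewrite mulr_ge0 ?cabs_ge0|exact: cabs_ge0| |].
      apply: ler_pM; rewrite ?cabs_ge0// ler_wpM2r ?invr_ge0//.
      by rewrite ler_wpM2r// norm_moebius_le1.
    apply: le_trans (H _) _; rewrite ler_wpM2l ?mulr_ge0//.
    exact: floor_succ_inv_le.
  by rewrite le_eqVlt; apply/orP; left; apply/eqP; field; rewrite !gt_eqF.
rewrite -mulr_suml sumrB sumr_const_nat subn1 -ln_factE.
apply: (@le_trans _ _ (N%:R * (4 * A / N%:R))); last first.
  by rewrite le_eqVlt; apply/orP; left; apply/eqP; field; rewrite gt_eqF.
rewrite ler_wpM2r ?divr_ge0 ?mulr_ge0 ?ler0n//.
by have := ln_fact_ge (R := R) N; rewrite -mulr_natl/=; lra.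
Qed.

End BoundedPartialSums.

(** * Non-vanishing for real characters *)

Section RealCharacter.
Context {R : realType}.
Variable chi : nat -> R.
Hypothesis chiM : forall m n, chi (m * n)%N = chi m * chi n.
Hypothesis chi1 : chi 1%N = 1.
Hypothesis chi_real : forall n, [|| chi n == 0, chi n == 1 | chi n == -1].

Definition divisor_sum n : R := \sum_(d <- divisors n) chi d.

(** The divisors of p n prime to p are those of its p'-part; the others are p times the divisors of
    n. *)
Lemma divisor_sum_prime p n : prime p -> (0 < n)%N ->
  divisor_sum (p * n) = divisor_sum ((p * n)`_p^'%N) + chi p * divisor_sum n.
Proof.
move=> pp n0; have p0 := prime_gt0 pp.
have pn0 : (0 < p * n)%N by rewrite muln_gt0 p0.
rewrite /divisor_sum [in LHS](@sum_divisors _ _ _ (p * n)%N) ?pn0 ?leqnn//.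
rewrite (bigID (fun d => p %| d)%N)/= addrC; congr (_ + _).
  rewrite (@sum_divisors _ _ _ (p * n)%N) ?part_gt0/=; last first.
    by rewrite dvdn_leq ?dvdn_part.
  apply: eq_bigl => d; apply/andP/idP => [[dn pd]|dn].
    by rewrite -(@part_pnat_id p^' d) ?p'natE// partn_dvd.
  split; first by rewrite (dvdn_trans dn)// dvdn_part.
  by rewrite -p'natE//; apply: pnat_dvd dn _; exact: part_pnat.
pose G k := if (p * k %| p * n)%N then chi (p * k) else 0.
transitivity (\sum_(1 <= i < (p * n).+1 | (p %| i)%N) G (i %/ p)%N).
  rewrite big_mkcondl/=; apply: eq_bigr => i pi.
  by rewrite /G (mulnC p (i %/ p)%N) divnK.
rewrite sum_multiples// mulKn// (@sum_divisors _ _ n n) ?n0 ?leqnn//.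
rewrite [in RHS]big_mkcond mulr_sumr; apply: eq_bigr => k _.
by rewrite /G dvdn_pmul2l// chiM; case: ifP; rewrite ?mulr0.
Qed.

(** The divisor sum is multiplicative, with value 1 + chi(p) + ... + chi(p)^k at p^k: this is
    non-negative, and at least 1 for even k. The induction strips the least prime p through
    [divisor_sum_prime] instead of factoring n. *)
Lemma divisor_sum_ge n : (0 < n)%N ->
  0 <= divisor_sum n /\ forall k, n = (k ^ 2)%N -> 1 <= divisor_sum n.
Proof.
elim/ltn_ind: n => n IH n0.
have [n1|n1] := leqP n 1.
  have -> : n = 1%N by apply/eqP; rewrite eqn_leq n1 n0.
  by rewrite /divisor_sum big_seq1 chi1; split.
pose p := pdiv n; have pp : prime p by exact: pdiv_prime.
have p0 := prime_gt0 pp; have p1 := prime_gt1 pp.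
have pn : (p %| n)%N by exact: pdiv_dvd.
have E : (n = p * (n %/ p))%N by rewrite mulnC divnK.
set m := (n %/ p)%N in E; have m0 : (0 < m)%N by rewrite divn_gt0// dvdn_leq.
have mn : (m < n)%N by rewrite E ltn_Pmull.
have q0 : (0 < n`_p^')%N by exact: part_gt0.
have qn : (n`_p^' < n)%N.
  rewrite ltn_neqAle dvdn_leq ?dvdn_part// andbT; apply/eqP => H.
  have := part_pnat p^' n; rewrite H p'natE//.
  by rewrite pn.
have [q_ge0 q_ge1] := IH _ qn q0.
have [m_ge0 m_ge1] := IH _ mn m0.
have sq k : n = (k ^ 2)%N -> (n`_p^' = (k`_p^') ^ 2)%N.
  by move=> ->; rewrite partnX.
have F := divisor_sum_prime pp m0; rewrite -E in F.
case/or3P: (chi_real p) => /eqP cp; rewrite cp in F.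
- rewrite mul0r addr0 in F; rewrite F; split=> // k /sq; exact: q_ge1.
- rewrite mul1r in F; rewrite F; split; first exact: addr_ge0.
  by move=> k /sq/q_ge1; lra.
(* Now chi(p) = -1. If p divides n exactly once the two terms cancel and n is not a square;
   otherwise applying the recursion twice removes p^2 without changing the value. *)
have [pm|pm] := boolP (p %| m)%N; last first.
  split.
    rewrite F (_ : n`_p^' = m)%N; first by rewrite mulN1r subrr.
    rewrite E partnM// part_p'nat ?mul1n ?part_pnat_id ?p'natE//.
    by rewrite pnatNK pnat_id.
  move=> k nk; exfalso; move: pm; rewrite /m nk.
  have pk : (p %| k)%N by move: pn; rewrite nk -mulnn Euclid_dvdM// orbb.
  by rewrite -mulnn -muln_divA// dvdn_mulr.
have Em : (m = p * (m %/ p))%N by rewrite mulnC divnK.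
set l := (m %/ p)%N in Em; have l0 : (0 < l)%N by rewrite divn_gt0// dvdn_leq.
have ln : (l < n)%N by apply: leq_trans mn; rewrite Em ltnS leq_pmull.
have [l_ge0 l_ge1] := IH _ ln l0.
have Fm := divisor_sum_prime pp l0; rewrite -Em cp in Fm.
have mq : (m`_p^' = n`_p^')%N.
  by rewrite E partnM// [X in (_ = X * _)%N]part_p'nat ?mul1n// pnatNK pnat_id.
have {F} F : divisor_sum n = divisor_sum l by rewrite F Fm mq; ring.
rewrite F; split=> // k nk; apply: (l_ge1 (k %/ p)%N).
have pk : (p %| k)%N by move: pn; rewrite nk -mulnn Euclid_dvdM// orbb.
apply/eqP; rewrite -(@eqn_pmul2l (p ^ 2)) ?expn_gt0 ?p0//.
by rewrite -expnMn (mulnC p (k %/ p)%N) divnK// -nk E Em mulnA.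
Qed.

End RealCharacter.

(** * Monsky's Lambert series *)

Section Lambert.
Context {R : realType}.
Variable y : R.
Hypotheses (y0 : 0 < y) (y1 : y < 1).
(** The variable of the series is t; its square root y is carried along so that geometric means of
    powers of t are integer powers of y. *)
Let t := y ^+ 2.

Let t0 : 0 < t. Proof. exact: exprn_gt0. Qed.
Let t1 : t < 1. Proof. by rewrite exprn_ilt1// ltW. Qed.
Let t1' : 0 < 1 - t. Proof. by rewrite subr_gt0. Qed.

Definition geom_sum (x : R) n : R := \sum_(i < n) x ^+ i.

Lemma geom_sumE (x : R) n : 1 - x ^+ n = (1 - x) * geom_sum x n.
Proof. by rewrite -opprB subrX1 -mulNr opprB. Qed.

(** The inequality of arithmetic and geometric means, for the pairs t^i and t^(n-1-i), whose product
    is y^(2(n-1)). *)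
Lemma geom_sum_sqr_ge_pred n : n%:R * y ^+ n.-1 <= geom_sum t n.
Proof.
have E : geom_sum t n *+ 2 = \sum_(i < n) (t ^+ i + t ^+ (n - i.+1)).
  by rewrite big_split/= mulr2n; congr (_ + _); rewrite /geom_sum (reindex_inj rev_ord_inj).
rewrite -(@ler_pMn2r _ 2)// E -[n in n%:R]card_ord -sumr_const mulr_suml -sumrMnl.
apply: ler_sum => i _; rewrite mul1r /t -!exprM.
case: n E i => [|n] E i; first by case: i.
rewrite subSS mulnC (mulnC 2%N) /=.
have -> : y ^+ n = y ^+ i * y ^+ (n - i).
  by rewrite -exprD subnKC// -ltnS.
rewrite !exprM; set a := y ^+ i; set b := y ^+ (n - i).
have := sqr_ge0 (a - b); rewrite mulr2n; nra.
Qed.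

Lemma geom_sum_sqr_ge n : n%:R * y ^+ n <= geom_sum t n.
Proof.
apply: le_trans (geom_sum_sqr_ge_pred n); rewrite ler_wpM2l//.
by rewrite ler_wiXn2l ?ltW// leq_pred.
Qed.

(** The first term, summed against chi, gives partial sums of L(1, chi) divided by 1 - t; the second
    is the Lambert weight, which generates divisor sums. The value at d = 1 is 1 for every t, so
    summation by parts gives a bound uniform in t. *)
Definition lambert_gap (d : nat) : R := (d%:R * (1 - t))^-1 - t ^+ d / (1 - t ^+ d).

Lemma lambert_gap1 : lambert_gap 1 = 1.
Proof. by rewrite /lambert_gap expr1 mul1r; field; rewrite gt_eqF. Qed.

Let g_gt0 n : (0 < n)%N -> 0 < geom_sum t n.
Proof.
move=> n0; apply: lt_le_trans (geom_sum_sqr_ge n).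
by rewrite mulr_gt0 ?ltr0n// exprn_gt0.
Qed.

Lemma lambert_gap_ge0 d : (0 < d)%N -> 0 <= lambert_gap d.
Proof.
move=> d0; have d0' : (0 : R) < d%:R by rewrite ltr0n.
rewrite /lambert_gap subr_ge0 geom_sumE ler_pdivrMr ?mulr_gt0 ?g_gt0//.
rewrite invfM -mulrA mulKf ?gt_eqF// ler_pdivlMl//.
apply: le_trans (geom_sum_sqr_ge d); rewrite ler_wpM2l//.
by rewrite /t -exprM ler_wiXn2l ?ltW// mul2n -addnn leq_addr.
Qed.

(** The field identity behind [lambert_gap_decr], with u for t, x for t^d and g for 1 + ... +
    t^(d-1); the relation between x and g is the geometric sum formula. *)
Lemma lambert_gap_diff (u d g x : R) : u < 1 -> 0 < d -> 0 < g ->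
  x = 1 - (1 - u) * g -> 0 < g + x ->
  (d * (1 - u))^-1 - x / ((1 - u) * g) -
  (((d + 1) * (1 - u))^-1 - u * x / ((1 - u) * (g + x))) =
  (1 - u)^-1 * ((d * (d + 1))^-1 - x / (g * (g + x))).
Proof.
move=> u1 d0 g0 Ex gx0.
have u1' : 0 < 1 - u by rewrite subr_gt0.
have d1 : 0 < d + 1 by rewrite addr_gt0.
have H : x / ((1 - u) * g) - u * x / ((1 - u) * (g + x)) =
    ((1 - u) * g + x) * (x / ((1 - u) * g * (g + x))).
  by field; rewrite !gt_eqF.
have S : (1 - u) * g + x = 1 by rewrite Ex addrC subrK.
transitivity ((d * (1 - u))^-1 - ((d + 1) * (1 - u))^-1 -
   (x / ((1 - u) * g) - u * x / ((1 - u) * (g + x)))); first by ring.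
by rewrite H S mul1r; field; rewrite !gt_eqF.
Qed.

(** By the identity above this amounts to d (d + 1) t^d <= g_d g_(d+1) for the geometric sums g, the
    product of g_d >= d y^d and g_(d+1) >= (d + 1) y^d. *)
Lemma lambert_gap_decr d : (0 < d)%N -> 0 <= lambert_gap d.+1 <= lambert_gap d.
Proof.
move=> d0; rewrite lambert_gap_ge0//=.
have d0' : (0 : R) < d%:R by rewrite ltr0n.
have d1' : (0 : R) < d.+1%:R by rewrite ltr0n.
have G0 := g_gt0 d0; have G1 := @g_gt0 d.+1 isT.
rewrite -subr_ge0.
have -> : lambert_gap d - lambert_gap d.+1 =
   (1 - t)^-1 * ((d%:R * d.+1%:R)^-1 - t ^+ d / (geom_sum t d * geom_sum t d.+1)).
  have Ed : t ^+ d = 1 - (1 - t) * geom_sum t d by rewrite -geom_sumE opprB addrC subrK.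
  have Eg : geom_sum t d.+1 = geom_sum t d + t ^+ d by rewrite /geom_sum big_ord_recr.
  rewrite /lambert_gap (geom_sumE t d) (geom_sumE t d.+1) (exprS t d).
  have -> : (d.+1%:R : R) = d%:R + 1 by rewrite -natr1.
  by rewrite Eg; apply: lambert_gap_diff => //; rewrite -Eg.
rewrite mulr_ge0 ?invr_ge0 ?(ltW t1')// subr_ge0.
rewrite ler_pdivrMr ?mulr_gt0// mulrC ler_pdivlMr ?mulr_gt0//.
have -> : t ^+ d * (d%:R * d.+1%:R) = (d%:R * y ^+ d) * (d.+1%:R * y ^+ d).
  by rewrite /t expr2 exprMn; ring.
apply: ler_pM; rewrite ?mulr_ge0 ?exprn_ge0 ?(ltW y0)//.
  exact: geom_sum_sqr_ge.
exact: (geom_sum_sqr_ge_pred d.+1).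
Qed.

(** With K = floor(N/d) this is the part of the d-th geometric series cut off when only the products
    d k <= N are kept. *)
Lemma lambert_tail (N K d : nat) : (0 < d <= N)%N -> (N <= d * K.+1)%N ->
  0 <= (t ^+ d) ^+ K.+1 / (1 - t ^+ d) <= t ^+ N / (1 - t).
Proof.
move=> /andP[d0 dN] NK; have td1 : t ^+ d <= t.
  by rewrite -[leRHS]expr1 ler_wiXn2l ?ltW.
have td0 : 0 <= t ^+ d by rewrite exprn_ge0 ?(ltW t0).
have td : 0 < 1 - t ^+ d by move: t1; lra.
apply/andP; split; first by apply: divr_ge0; [exact: exprn_ge0|exact: ltW].
apply: ler_pM.
- by rewrite exprn_ge0.
- by rewrite invr_ge0 ltW.
- by rewrite -exprM ler_wiXn2l ?ltW.
- by rewrite lef_pV2 ?posrE//; lra.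
Qed.

(* Monsky's argument: the Lambert series of [chi] is the power series of its
   divisor sums, while its terms differ from those of the harmonic series
   [sum chi n / (n (1 - t))] by a decreasing weight. *)
Lemma lambert_upper (chi : nat -> R) (A S : R) (N : nat) :
  (forall n, `|chi n| <= 1) ->
  (forall N, `|\sum_(1 <= n < N.+1) chi n| <= A) ->
  `|\sum_(1 <= n < N.+1) chi n / n%:R| <= S ->
  \sum_(1 <= m < N.+1) divisor_sum chi m * t ^+ m <=
    A + S / (1 - t) + N%:R * (t ^+ N / (1 - t)).
Proof.
move=> chi_le1 chi_sum chi_S.
have chi_sum' k : cabs (\sum_(1 <= n < k) (chi n)%:C%C) <= A.
  rewrite (_ : \sum_(_ <= _ < _) _ = (\sum_(1 <= n < k) chi n)%:C%C);
    last by rewrite rmorph_sum.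
  rewrite cabs_real; case: k => [|k]; last exact: chi_sum.
  by have := chi_sum 0%N; rewrite !big_geq.
have -> : \sum_(1 <= m < N.+1) divisor_sum chi m * t ^+ m =
  \sum_(1 <= d < N.+1) chi d * \sum_(1 <= k < (N %/ d).+1) (t ^+ d) ^+ k.
  under [RHS]eq_bigr do rewrite mulr_sumr.
  rewrite -(dirichlet_hyperbola (fun d k => chi d * (t ^+ d) ^+ k)).
  apply: eq_big_nat => n /andP[n0 _]; rewrite /divisor_sum mulr_suml.
  apply: eq_big_seq => d; rewrite -dvdn_divisors// => dn.
  by rewrite -exprM mulnC divnK.
have td d : (0 < d)%N -> 0 < 1 - t ^+ d.
  move=> d0; rewrite subr_gt0; apply: le_lt_trans t1.
  by rewrite -[leRHS]expr1 ler_wiXn2l ?ltW.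
have -> : \sum_(1 <= d < N.+1) chi d * \sum_(1 <= k < (N %/ d).+1) (t ^+ d) ^+ k =
   (\sum_(1 <= d < N.+1) chi d / d%:R) / (1 - t)
   - \sum_(1 <= d < N.+1) chi d * lambert_gap d
   - \sum_(1 <= d < N.+1) chi d * ((t ^+ d) ^+ (N %/ d).+1 / (1 - t ^+ d)).
  rewrite mulr_suml -!sumrB; apply: eq_big_nat => d /andP[d0 _].
  have -> : \sum_(1 <= k < (N %/ d).+1) (t ^+ d) ^+ k =
      t ^+ d / (1 - t ^+ d) - (t ^+ d) ^+ (N %/ d).+1 / (1 - t ^+ d).
    rewrite -mulrBl; apply: (mulIf (lt0r_neq0 (td d d0))).
    rewrite divfK ?lt0r_neq0 ?td//; elim: (N %/ d)%N => [|k IH].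
      by rewrite big_geq// mul0r subrr.
    by rewrite big_nat_recr//= mulrDl IH (exprS _ k.+1); ring.
  rewrite /lambert_gap invfM; ring.
rewrite (addrC A); apply: lerD; [apply: lerD|].
- rewrite ler_wpM2r ?invr_ge0 ?(ltW t1')//.
  by apply: le_trans chi_S; exact: ler_norm.
- rewrite lerNl; apply: le_trans (_ : - cabs (\sum_(1 <= d < N.+1) (chi d)%:C%C * (lambert_gap d)%:C%C) <= _).
    rewrite lerN2 -[A]mulr1 -lambert_gap1; apply: abel_summation_bound => //.
    by move=> n n0; exact: lambert_gap_decr.
  rewrite (_ : \sum_(1 <= d < N.+1) (chi d)%:C%C * _ =
     (\sum_(1 <= d < N.+1) chi d * lambert_gap d)%:C%C); last first.
    by rewrite rmorph_sum/=; apply: eq_bigr => d _; rewrite rmorphM.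
  by rewrite cabs_real lerNl ler_normr lexx orbT.
- apply: le_trans (ler_norm _) _; rewrite normrN.
  apply: le_trans (ler_norm_sum _ _ _) _.
  have -> : N%:R * (t ^+ N / (1 - t)) = \sum_(1 <= d < N.+1) t ^+ N / (1 - t).
    by rewrite sumr_const_nat subn1 mulr_natl.
  apply: ler_sum_nat => d; rewrite ltnS => dN.
  have dK : (N <= d * (N %/ d).+1)%N.
    by rewrite mulnC; apply: ltnW; apply: ltn_ceil; case/andP: dN.
  have /andP[l0 l1] := lambert_tail dN dK.
  by rewrite normrM (ger0_norm l0) -[leRHS]mul1r ler_pM.
Qed.

Lemma lambert_lower (F : nat -> R) (J N : nat) :
  (forall m, (0 < m)%N -> 0 <= F m) -> (forall k, (0 < k)%N -> 1 <= F (k ^ 2)%N) ->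
  (J ^ 2 <= N)%N ->
  J%:R * t ^+ (J ^ 2) <= \sum_(1 <= m < N.+1) F m * t ^+ m.
Proof.
move=> F0 F1 JN.
have term m : (0 < m)%N -> 0 <= F m * t ^+ m.
  by move=> m0; rewrite mulr_ge0 ?F0// exprn_ge0// ltW.
have H : forall i, (i <= J)%N ->
    i%:R * t ^+ (J ^ 2) <= \sum_(1 <= m < (i ^ 2).+1) F m * t ^+ m.
  elim=> [|i IH] iJ; first by rewrite mul0r big_geq.
  have ii : (i ^ 2 < i.+1 ^ 2)%N by rewrite ltn_sqr.
  rewrite -natr1 mulrDl mul1r (@big_cat_nat _ _ _ (i ^ 2).+1)//=; last exact: ltnW.
  apply: lerD; first by apply: IH; exact: ltnW.
  rewrite big_nat_recr//= -[leLHS]add0r; apply: lerD.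
    rewrite big_nat_cond; apply: sumr_ge0 => m /andP[/andP[im _] _].
    by apply: term; apply: leq_ltn_trans im.
  rewrite -[leLHS]mul1r; apply: ler_pM => //; first by rewrite exprn_ge0// ltW.
    exact: F1.
  by rewrite ler_wiXn2l ?(ltW t0) ?(ltW t1)// leq_sqr.
apply: le_trans (H J (leqnn J)) _.
rewrite [leRHS](@big_cat_nat _ _ _ (J ^ 2).+1)//= lerDl big_nat_cond.
apply: sumr_ge0 => m /andP[/andP[im _] _].
by apply: term; apply: leq_ltn_trans im.
Qed.

(** N y^N is at most 1 + y + ... + y^(N-1), hence at most 1/(1 - y). Squaring bounds N^2 t^N, which
    leaves a factor 1/N for fixed y. *)
Lemma lambert_remainder (N : nat) : (0 < N)%N ->
  N%:R * (t ^+ N / (1 - t)) <= ((1 - y) ^+ 2 * (1 - t))^-1 / N%:R.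
Proof.
move=> N0; have N0' : (0 : R) < N%:R by rewrite ltr0n.
have y1' : 0 < 1 - y by rewrite subr_gt0.
have H : N%:R * y ^+ N <= (1 - y)^-1.
  rewrite -[leRHS]mul1r ler_pdivlMr//.
  apply: le_trans (_ : geom_sum y N * (1 - y) <= _).
    rewrite ler_wpM2r ?(ltW y1')// -[N in N%:R]card_ord -sumr_const mulr_suml.
    by apply: ler_sum => i _; rewrite mul1r ler_wiXn2l ?(ltW y0) ?(ltW y1)// ltnW.
  by rewrite mulrC -geom_sumE lerBlDr lerDl exprn_ge0// ltW.
have H2 : (N%:R * y ^+ N) ^+ 2 <= (1 - y)^-1 ^+ 2.
  rewrite lerXn2r ?nnegrE ?invr_ge0 ?(ltW y1')//.
  by rewrite mulr_ge0// exprn_ge0// ltW.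
have -> : N%:R * (t ^+ N / (1 - t)) = (N%:R * y ^+ N) ^+ 2 * (1 - t)^-1 / N%:R.
  by rewrite /t exprAC; field; rewrite !gt_eqF.
rewrite invfM exprVn in H2 *.
by rewrite ler_wpM2r ?invr_ge0 ?ler0n// ler_wpM2r ?invr_ge0 ?(ltW t1').
Qed.

End Lambert.

Lemma nat_above {R : realType} (x : R) : exists n : nat, x <= n%:R.
Proof.
exists (Num.bound `|x|); apply: ltW; apply: le_lt_trans (ler_norm x) _.
exact: archi_boundP.
Qed.

(** If L(1, chi) were 0, the Lambert series would stay bounded by A as t tends to 1, while the
    squares alone make it at least J t^(J^2) for every J. *)
Lemma real_character_nonvanishing {R : realType} (chi : nat -> R) (A K : R) :
  (forall m n, chi (m * n)%N = chi m * chi n) -> chi 1%N = 1 ->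
  (forall n, [|| chi n == 0, chi n == 1 | chi n == -1]) ->
  (forall N, `|\sum_(1 <= n < N.+1) chi n| <= A) ->
  ~ (forall N, `|\sum_(1 <= n < N.+1) chi n / n%:R| <= K / N.+1%:R).
Proof.
move=> chiM chi1 chi_real chi_sum chi_zero.
have chi_le1 n : `|chi n| <= 1.
  by case/or3P: (chi_real n) => /eqP->; rewrite ?normr0 ?normrN ?normr1.
(* J/2 has to exceed A + 2: the bound A of the summation by parts and two error terms of at most 1
   each. *)
have [J JA] := nat_above (2 * (A + 2) + 1).
have A0 : 0 <= A by apply: le_trans (chi_sum 0%N).
have K0 : 0 <= K by have := le_trans (normr_ge0 _) (chi_zero 0%N); rewrite divr1.
have J0 : (0 : R) < J%:R by apply: lt_le_trans JA; lra.
have J1 : (1 : R) <= J%:R by apply: le_trans JA; lra.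
(* e is 1 - t; Bernoulli's inequality then gives t^(J^2) >= 1 - J^2 e = 1/2. *)
pose e : R := (2 * J%:R ^+ 2)^-1.
have e0 : 0 < e by rewrite invr_gt0 mulr_gt0// exprn_gt0.
have e1 : e < 1.
  rewrite invf_lt1 ?mulr_gt0 ?exprn_gt0//.
  have : 1 <= J%:R ^+ 2 :> R by rewrite exprn_ege1.
  lra.
pose y := Num.sqrt (1 - e).
have y0 : 0 < y by rewrite sqrtr_gt0; lra.
have y2 : y ^+ 2 = 1 - e by rewrite sqr_sqrtr//; lra.
have y1 : y < 1 by rewrite -(@expr_lt1 _ 2)// ?ltW// y2; lra.
(* The truncation N is chosen after t: N1 controls the partial sum of L(1, chi) divided by 1 - t,
   and N2 the remainder. *)
have [N1 HN1] := nat_above (K / e).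
have [N2 HN2] := nat_above (((1 - y) ^+ 2 * e)^-1).
pose N := (J ^ 2 + N1 + N2)%N.
have JJ : (J ^ 2 <= N)%N by rewrite /N -addnA leq_addr.
have N0 : (0 < N)%N.
  by apply: leq_trans JJ; rewrite expn_gt0 -(ltr0n R) J0.
have N0' : (0 : R) < N%:R by rewrite ltr0n.
have F0 m : (0 < m)%N -> 0 <= divisor_sum chi m.
  by move=> m0; have [] := divisor_sum_ge chiM chi1 chi_real m0.
have F1 k : (0 < k)%N -> 1 <= divisor_sum chi (k ^ 2).
  move=> k0; have k2 : (0 < k ^ 2)%N by rewrite expn_gt0 k0.
  by have [_ /(_ k erefl)] := divisor_sum_ge chiM chi1 chi_real k2.
have lo := lambert_lower y0 y1 F0 F1 JJ.
have up := lambert_upper y0 y1 chi_le1 chi_sum (chi_zero N).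
have rem := lambert_remainder y0 y1 N0.
have Ee : 1 - y ^+ 2 = e by rewrite y2 opprB addrC subrK.
rewrite !Ee in up rem.
have S1 : K / N.+1%:R / e <= 1.
  rewrite ler_pdivrMr// mul1r ler_pdivrMr ?ltr0n// mulrC -ler_pdivrMr//.
  apply: le_trans HN1 _; rewrite ler_nat (leq_trans _ (leqnSn N))//.
  by rewrite /N addnAC leq_addl.
have S2 : ((1 - y) ^+ 2 * e)^-1 / N%:R <= 1.
  rewrite ler_pdivrMr// mul1r; apply: le_trans HN2 _.
  by rewrite ler_nat /N leq_addl.
have S3 : 2^-1 <= (y ^+ 2) ^+ (J ^ 2).
  have H : forall n, 1 - n%:R * e <= (1 - e) ^+ n.
    elim=> [|n IH]; first by rewrite mul0r subr0.
    rewrite exprS -natr1; apply: le_trans (_ : (1 - e) * (1 - n%:R * e) <= _).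
      have : 0 <= n%:R * e * e by rewrite !mulr_ge0// ltW.
      lra.
    by rewrite ler_wpM2l//; lra.
  rewrite y2; apply: le_trans (H _); rewrite /e natrX.
  have -> : J%:R ^+ 2 * (2 * J%:R ^+ 2)^-1 = 2^-1 :> R by field; rewrite gt_eqF.
  lra.
have S4 : J%:R * 2^-1 <= J%:R * (y ^+ 2) ^+ (J ^ 2) by rewrite ler_pM2l.
move: (le_trans S4 (le_trans lo up)) (le_trans rem S2) S1 JA.
move: (K / _ / e) (N%:R * (_ / e)) => u v; lra.
Qed.

(** * Dirichlet's theorem *)

Section DirichletCharacters.
Context {R : realType}.
Variable M : nat.
Hypothesis M1 : (1 < M)%N.

Let gT : finGroupType := {unit 'Z_M}.
(* Characters of the unit group are encoded as homomorphisms to the additive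
   group ['Z_N].  The exponent of the group divides [N], and the factor 2 avoids
   ['Z_1], which is [Z/2]. *)
Let N := (2 * #|gT|)%N.

Let N1 : (1 < N)%N.
Proof. by rewrite -[2%N]muln1 leq_mul//; apply/card_gt0P; exists 1%g. Qed.

Let N0 : (0 < N)%N. Proof. exact: ltnW. Qed.

Definition unit_homs : {set {ffun gT -> 'Z_N}} :=
  [set k : {ffun gT -> 'Z_N} | [forall x, forall y, k (x * y)%g == k x + k y]].

Lemma unit_homsP (k : {ffun gT -> 'Z_N}) :
  reflect (forall x y, k (x * y)%g = k x + k y) (k \in unit_homs).
Proof.
rewrite inE; apply: (iffP forallP) => [H x y|H x]; first by have /forallP/(_ y)/eqP := H x.
by apply/forallP => y; apply/eqP.
Qed.

Lemma unit_homs0 : 0 \in unit_homs.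
Proof. by apply/unit_homsP => x y; rewrite !ffunE addr0. Qed.

Lemma unit_homsD k l : k \in unit_homs -> l \in unit_homs -> k + l \in unit_homs.
Proof.
move=> /unit_homsP Hk /unit_homsP Hl; apply/unit_homsP => x y.
by rewrite !ffunE Hk Hl addrACA.
Qed.

Lemma unit_homsN k : k \in unit_homs -> - k \in unit_homs.
Proof.
move=> /unit_homsP Hk; apply/unit_homsP => x y.
by rewrite !ffunE Hk opprD.
Qed.

(** The kernels of the linear characters intersect in the derived subgroup, which is trivial here.
    The values of a separating character are N-th roots of unity in the algebraic numbers; recording
    their exponents allows evaluation at a root of unity of [R[i]]. *)
Lemma unit_homs_separate (x : gT) : x != 1%g ->
  exists2 k, k \in unit_homs & k x != 0.
Proof.
move=> x1.
have abG : abelian [set: gT].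
  by apply/centsP => u _ v _; apply: val_inj; rewrite !FinRing.val_unitM mulrC.
have [i [li xi]] : exists i : Iirr [set: gT], 'chi_i \is a linear_char /\ x \notin cfker 'chi_i.
  apply/not_existsP => H.
  have : x \in \bigcap_(i | 'chi[[set: gT]]_i \is a linear_char) cfker 'chi_i.
    apply/bigcapP => i li; apply/negbNE/negP => xi; exact: (H i).
  rewrite cap_cfker_lin_irr (derG1P abG) inE; exact/negP.
have [z zN] := C_prim_root_exists N0.
have chiN y : ('chi_i y) ^+ N = 1.
  rewrite -lin_charX ?inE//.
  by rewrite /N mulnC expgM -cardsT expg_cardG ?inE// expg1n lin_char1.
pose e y := sval (prim_rootP zN (chiN y)).
have eP y : z ^+ e y = 'chi_i y by rewrite /e; case: prim_rootP.
pose k := [ffun y => inZp (e y) : 'Z_N].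
have kP y : z ^+ k y = 'chi_i y.
  rewrite -eP; apply/eqP; rewrite (eq_prim_root_expr zN) ffunE /=.
  by rewrite Zp_cast// modn_mod.
exists k.
  apply/unit_homsP => u v; apply: val_inj; apply/eqP.
  have : z ^+ k (u * v)%g == z ^+ (k u + k v)%N.
    by rewrite exprD !kP lin_charM ?inE.
  rewrite (eq_prim_root_expr zN) modn_small; last by rewrite -[X in (_ < X)%N]Zp_cast// ltn_ord.
  move/eqP=> E; apply/eqP; apply: (etrans E).
  by rewrite /= [X in _ = (_ %% X)%N](Zp_cast N1).
apply: contra xi => /eqP kx.
by rewrite cfkerEirr !inE/= -kP kx expr0 lin_char1.
Qed.

Lemma complex_prim_root : {w : R[i] | N.-primitive_root w}.
Proof.
pose p : {poly R[i]} := 'X^N - 1.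
have [r Dp] := closed_field_poly_normal p.
move: Dp; rewrite lead_coefXnsubC// scale1r => Dp.
have rn1 : all N.-unity_root r by apply/allP=> z; rewrite -root_prod_XsubC -Dp.
have sr : size r = N.
  have : size p = N.+1 by rewrite /p -polyC1 size_XnsubC.
  by rewrite Dp size_prod_XsubC => -[].
have ur : uniq r.
  rewrite -separable_prod_XsubC -Dp; apply: separable_Xn_sub_1.
  by rewrite pnatr_eq0 -lt0n.
have /has_prim_root := rn1; rewrite sr => /(_ N0 ur (leqnn _)) /hasP H.
by apply: cid; case: H => w _ ?; exists w.
Qed.

Let w : R[i] := sval complex_prim_root.
Let wN : N.-primitive_root w. Proof. exact: (svalP complex_prim_root). Qed.

Let cabs_w : cabs w = 1.
Proof.
apply/eqP; rewrite -(@pexpr_eq1 _ _ N) ?cabs_ge0// -cabsX (prim_expr_order wN).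
by rewrite cabs1.
Qed.

Let w_eq1 (i : 'Z_N) : (w ^+ i == 1) = (i == 0).
Proof.
rewrite -(expr0 w) (eq_prim_root_expr wN) mod0n modn_small//.
by rewrite -[X in (_ < X)%N]Zp_cast// ltn_ord.
Qed.

Let wD (i j : 'Z_N) : w ^+ (i + j)%R = w ^+ i * w ^+ j.
Proof.
rewrite -exprD; apply/eqP; rewrite (eq_prim_root_expr wN) /=.
by rewrite [X in (_ %% X %% _)%N](Zp_cast N1) modn_mod.
Qed.

(** The Dirichlet character of exponents k. In the first branch x is a unit, so the default of
    [insubd] is never taken. *)
Definition zchar (k : {ffun gT -> 'Z_N}) (x : 'Z_M) : R[i] :=
  if x \is a GRing.unit then w ^+ k (insubd (1%g : gT) x) else 0.

Lemma zcharM k x y : k \in unit_homs -> zchar k (x * y) = zchar k x * zchar k y.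
Proof.
move=> /unit_homsP Hk; rewrite /zchar unitrM.
case: ifPn => [/andP[ux uy]|]; last first.
  by rewrite negb_and => /orP[] /negbTE ->; rewrite ?mul0r ?mulr0.
rewrite ux uy -wD -Hk; congr (w ^+ k _); apply: val_inj.
by rewrite FinRing.val_unitM !insubdK// unfold_in/= unitrM ux uy.
Qed.

Lemma zchar1 k : k \in unit_homs -> zchar k 1 = 1.
Proof.
move=> /unit_homsP Hk; rewrite /zchar unitr1.
have -> : insubd (1%g : gT) 1 = 1%g by apply: val_inj; rewrite insubdK// unfold_in unitr1.
have : k 1%g = k 1%g + k 1%g by rewrite -Hk mulg1.
by move/eqP; rewrite -subr_eq subrr => /eqP <-; rewrite expr0.
Qed.

Lemma cabs_zchar k x : cabs (zchar k x) = (x \is a GRing.unit)%:R.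
Proof. by rewrite /zchar; case: ifP => _; rewrite ?cabs0// cabsX cabs_w expr1n. Qed.

Lemma zchar_nonunit k x : x \isn't a GRing.unit -> zchar k x = 0.
Proof. by rewrite /zchar => /negbTE ->. Qed.

Lemma zchar_trivial x : zchar 0 x = (x \is a GRing.unit)%:R.
Proof. by rewrite /zchar; case: ifP => _ //; rewrite ffunE expr0. Qed.

Lemma zcharD k l x : zchar (k + l) x = zchar k x * zchar l x.
Proof. by rewrite /zchar; case: ifP => _; rewrite ?mul0r// ffunE wD. Qed.

Lemma zcharN k x : zchar (- k) x = conjc (zchar k x).
Proof.
have [ux|nx] := boolP (x \is a GRing.unit); last first.
  by rewrite !zchar_nonunit// conjc0.
have nz : zchar k x != 0 by rewrite -cabs_eq0 cabs_zchar ux oner_eq0.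
apply: (mulfI nz); rewrite -zcharD subrr zchar_trivial ux.
have := cabs_zchar k x; rewrite ux; case: (zchar k x) => a b H.
have := cabs_sqr (Complex a b); rewrite H expr1n /= => E.
by apply/eqP; rewrite eq_complex/=; apply/andP; split; apply/eqP; lra.
Qed.

Lemma sum_zchar k : k \in unit_homs -> k != 0 -> \sum_x zchar k x = 0.
Proof.
move=> hk k0.
have [g kg] : exists g, k g != 0.
  apply/not_existsP => H; case/negP: k0; apply/eqP/ffunP => g.
  by rewrite ffunE; apply/eqP; apply/negbNE/negP; exact: H.
have ug : val g \is a GRing.unit by exact: (valP g).
have E : \sum_x zchar k x = zchar k (val g) * \sum_x zchar k x.
  rewrite mulr_sumr (reindex_inj (mulrI ug)).
  by apply: eq_bigr => x _; rewrite zcharM.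
have : (zchar k (val g) - 1) * \sum_x zchar k x = 0.
  by rewrite mulrBl mul1r -E subrr.
move/eqP; rewrite mulf_eq0 => /orP[|/eqP//].
rewrite subr_eq0 /zchar ug valKd.
by rewrite w_eq1 (negbTE kg).
Qed.

(** For a unit x other than 1, translation by a homomorphism that is non-zero at x multiplies the
    sum by a number different from 1. *)
Lemma sum_homs_zchar x :
  \sum_(k in unit_homs) zchar k x = (x == 1)%:R * #|unit_homs|%:R.
Proof.
case: eqVneq => [->|x1].
  rewrite mul1r -sumr_const; apply: eq_bigr => k hk; exact: zchar1.
rewrite mul0r.
have [ux|nx] := boolP (x \is a GRing.unit); last first.
  by rewrite big1// => k _; rewrite zchar_nonunit.
pose g := insubd (1%g : gT) x.
have vg : val g = x by rewrite insubdK.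
have g1 : g != 1%g by apply: contra x1 => /eqP H; rewrite -vg H.
have [l hl lg] := unit_homs_separate g1.
have E : \sum_(k in unit_homs) zchar k x = zchar l x * \sum_(k in unit_homs) zchar k x.
  rewrite mulr_sumr (reindex_inj (addrI l)); apply: eq_big => [k|k _]; last exact: zcharD.
  apply/idP/idP => hk; last exact: unit_homsD.
  by rewrite -(addKr l k) unit_homsD ?unit_homsN.
have : (zchar l x - 1) * \sum_(k in unit_homs) zchar k x = 0.
  by rewrite mulrBl mul1r -E subrr.
move/eqP; rewrite mulf_eq0 => /orP[|/eqP//].
by rewrite subr_eq0 /zchar ux w_eq1 (negbTE lg).
Qed.

Definition dchar k (n : nat) : R[i] := zchar k n%:R.

Lemma dcharM k m n : k \in unit_homs -> dchar k (m * n)%N = dchar k m * dchar k n.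
Proof. by move=> hk; rewrite /dchar natrM zcharM. Qed.

Lemma cabs_dchar_le1 k n : cabs (dchar k n) <= 1.
Proof. by rewrite /dchar cabs_zchar; case: (_ \is a _). Qed.

Lemma dchar_unit n : ((n%:R : 'Z_M) \is a GRing.unit) = coprime n M.
Proof. by rewrite unitZpE// coprime_sym. Qed.

(** Complete periods cancel, and at most M terms of modulus at most 1 remain. *)
Lemma dchar_sum k n : k \in unit_homs -> k != 0 ->
  cabs (\sum_(1 <= i < n.+1) dchar k i) <= M%:R.
Proof.
move=> hk k0; have M0 : (0 < M)%N := ltnW M1.
have -> : \sum_(1 <= i < n.+1) dchar k i = \sum_(0 <= i < n.+1) dchar k i.
  have d0 : dchar k 0 = 0.
    by apply: zchar_nonunit; rewrite dchar_unit /coprime gcd0n gtn_eqF.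
  by rewrite [RHS]big_ltn// d0 add0r.
have per i : dchar k (i + M) = dchar k i.
  by rewrite /dchar natrD (_ : M%:R = 0) ?addr0// pchar_Zp.
have z0 : \sum_(0 <= i < M) dchar k i = 0.
  have -> : \sum_(0 <= i < M) dchar k i = \sum_x zchar k x; last exact: sum_zchar.
  rewrite -[X in index_iota 0 X](Zp_cast M1) big_mkord.
  by apply: eq_bigr => x _; rewrite /dchar natr_Zp.
elim/ltn_ind: {n}n.+1 => n IH.
have [nM|Mn] := leqP n M.
  apply: le_trans (ler_cabs_sum _ _ _) _.
  apply: le_trans (_ : \sum_(0 <= i < n) 1 <= _).
    by apply: ler_sum => i _; exact: cabs_dchar_le1.
  by rewrite sumr_const_nat subn0 ler_nat.
rewrite (@big_cat_nat _ _ _ M)//= 1?ltnW// z0 add0r.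
have -> : \sum_(M <= i < n) dchar k i = \sum_(0 <= i < n - M) dchar k i.
  rewrite -{1}(add0n M) big_addn; apply: eq_bigr => i _; exact: per.
by apply: IH; rewrite ltn_subrL M0 (ltn_trans M0 Mn).
Qed.

Lemma dchar1 k : k \in unit_homs -> dchar k 1 = 1.
Proof. exact: zchar1. Qed.

Let bounded_sum k : k \in unit_homs -> k != 0 ->
  forall n, cabs (\sum_(1 <= i < n.+1) dchar k i) <= M%:R :> R.
Proof. by move=> hk k0 n; exact: dchar_sum. Qed.

(** Opposite exponents give the conjugate character; if both agree the values are real, hence 0, 1
    or -1, and [real_character_nonvanishing] applies. *)
Lemma dchar_zero_neq_opp k : k \in unit_homs -> k != 0 ->
  (forall n, cabs (chi_over_n (dchar k) n) <= 4 * M%:R / n.+1%:R) -> - k != k.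
Proof.
move=> hk k0 H; apply/eqP => kk.
have im x : complex.Im (zchar k x) = 0.
  have := zcharN k x; rewrite kk; case: (zchar k x) => a b [] /=; lra.
pose f n : R := complex.Re (dchar k n).
have fE n : dchar k n = (f n)%:C%C.
  by rewrite /f; have := im n%:R; rewrite /dchar; case: (zchar _ _) => a b /= ->.
apply: (@real_character_nonvanishing R f M%:R (4 * M%:R)).
- move=> m n; apply: (@complexI R); rewrite rmorphM/= -!fE; exact: dcharM.
- by apply: (@complexI R); rewrite -fE dchar1.
- move=> n; have [un|nu] := boolP ((n%:R : 'Z_M) \is a GRing.unit); last first.
    by rewrite /f /dchar zchar_nonunit//= eqxx.
  have := cabs_zchar k n%:R; rewrite un -/(dchar k n) fE cabs_real.
  by move/eqP; rewrite eqr_norml => /andP[/orP[|] ->]; rewrite ?orbT.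
- move=> n; rewrite -cabs_real rmorph_sum/=.
  by under eq_bigr do rewrite -fE; exact: dchar_sum.
- move=> n; have := H n; rewrite /chi_over_n.
  under eq_bigr do rewrite fE -rmorphM.
  by rewrite -rmorph_sum cabs_real.
Qed.

Lemma principal_vonMangoldt n :
  chi_vonMangoldt (dchar 0) n =
  (\sum_(1 <= i < n.+1 | coprime i M) vonMangoldt i / i%:R)%:C%C.
Proof.
rewrite /chi_vonMangoldt rmorph_sum/= [RHS]big_mkcond/=; apply: eq_bigr => i _.
rewrite /dchar zchar_trivial dchar_unit.
by case: (coprime i M); rewrite ?mul1r ?mul0r.
Qed.

Lemma sum_homs_vonMangoldt (a : 'Z_M) n : a \is a GRing.unit ->
  \sum_(k in unit_homs) zchar k a^-1 * chi_vonMangoldt (dchar k) n =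
  (#|unit_homs|%:R * \sum_(1 <= i < n.+1 | (i%:R : 'Z_M) == a) vonMangoldt i / i%:R)%:C%C.
Proof.
move=> ua; rewrite /chi_vonMangoldt rmorphM/= rmorph_nat rmorph_sum/=.
under eq_bigr do rewrite mulr_sumr.
rewrite exchange_big/= mulr_sumr [RHS]big_mkcond/=; apply: eq_bigr => i _.
under eq_bigr => k hk do rewrite mulrA /dchar -zcharM//.
rewrite -mulr_suml sum_homs_zchar.
have -> : (a^-1 * i%:R == 1) = ((i%:R : 'Z_M) == a).
  by rewrite -(inj_eq (mulrI ua)) mulrA divrr// mul1r mulr1.
by case: eqP; rewrite ?mul1r ?mul0r.
Qed.

Lemma zero_dchar_vonMangoldt k : k \in unit_homs -> k != 0 ->
  (forall n, cabs (chi_over_n (dchar k) n) <= 4 * M%:R / n.+1%:R) ->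
  forall n, (0 < n)%N ->
    complex.Re (chi_vonMangoldt (dchar k) n) <= - ln n%:R + 4 * M%:R.
Proof.
move=> hk k0 H n n0.
have := @chi_vonMangoldt_zero R (dchar k) M%:R (fun m n => @dcharM k m n hk)
  (dchar1 hk) (cabs_dchar_le1 k) (bounded_sum hk k0) H n n0.
move/(le_trans (ler_Re_cabs _)); rewrite ler_norml => /andP[_].
rewrite raddfD/=; lra.
Qed.

Lemma dchar_vonMangoldt_cases k : k \in unit_homs -> k != 0 ->
  (forall n, cabs (chi_over_n (dchar k) n) <= 4 * M%:R / n.+1%:R) \/
  exists K, forall n, cabs (chi_vonMangoldt (dchar k) n) <= K.
Proof.
move=> hk k0.
have [L HL] := @chi_over_n_cvg R (dchar k) M%:R (bounded_sum hk k0).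
have [L0|L0] := eqVneq L 0.
  by left=> n; have := HL n; rewrite L0 subr0.
right; exact: (@chi_vonMangoldt_bounded R (dchar k) M%:R (fun m n => @dcharM k m n hk)
  (cabs_dchar_le1 k) (bounded_sum hk k0) L L0 HL).
Qed.

Lemma ln_nat_unbounded (K : R) : exists2 n, (0 < n)%N & K < ln n%:R.
Proof.
have [n Hn] := nat_above (expR (K + 1)).
have n0 : (0 : R) < n%:R by apply: lt_le_trans Hn; exact: expR_gt0.
exists n; first by rewrite -(ltr0n R).
have : K + 1 <= ln n%:R by rewrite -(expRK (K + 1)) ler_ln ?posrE// expR_gt0.
lra.
Qed.

(** A vanishing character k comes with its conjugate, a different one. In the residue class of 1 the
    two contribute -2 ln n against the ln n of the principal character, although the total is
    non-negative. *)
Lemma dchar_nonvanishing k : k \in unit_homs -> k != 0 ->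
  ~ (forall n, cabs (chi_over_n (dchar k) n) <= 4 * M%:R / n.+1%:R).
Proof.
move=> hk k0 H.
have kk := dchar_zero_neq_opp hk k0 H.
have hNk := unit_homsN hk.
have Nk0 : - k != 0 by rewrite oppr_eq0.
have HN n : cabs (chi_over_n (dchar (- k)) n) <= 4 * M%:R / n.+1%:R.
  apply: le_trans (H n); rewrite -cabs_conj /chi_over_n rmorph_sum/=.
  rewrite le_eqVlt; apply/orP; left; apply/eqP; congr cabs.
  apply: eq_bigr => i _; rewrite rmorphM; congr (_ * _); last exact: conjc_real.
  by rewrite /= -zcharN opprK.
(* Upper bounds on real parts suffice: a further vanishing character would contribute -ln n + O(1),
   which is also bounded above. *)
have /boolp.choice[K HK] : forall l : {ffun gT -> 'Z_N}, exists b : R,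
    l \in unit_homs -> l != 0 ->
    forall n, (0 < n)%N -> complex.Re (chi_vonMangoldt (dchar l) n) <= b.
  move=> l.
  have [hl|] := boolP (l \in unit_homs); last by exists 0.
  have [->|l0] := eqVneq l 0; first by exists 0.
  have [Hl|[K HK]] := dchar_vonMangoldt_cases hl l0.
    exists (4 * M%:R) => _ _ n n0; apply: le_trans (zero_dchar_vonMangoldt hl l0 Hl n0) _.
    by have := ln_nat_ge0 (R := R) n; lra.
  exists K => _ _ n _; apply: le_trans (HK n).
  by apply: le_trans (ler_Re_cabs _); exact: ler_norm.
pose rest := \sum_(l | (l \in unit_homs) && (l != 0) && (l != k) && (l != - k)) K l.
(* 4 is the Mertens constant of the principal character, and k and its opposite cost 4M each. *)
have [n n0 Hn] := ln_nat_unbounded (4 + 8 * M%:R + rest).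
have := sum_homs_vonMangoldt n (unitr1 'Z_M).
move/(congr1 (@complex.Re R)); rewrite raddf_sum.
under eq_bigr => l hl do rewrite invr1 zchar1// mul1r.
rewrite (bigD1 (0 : {ffun gT -> 'Z_N})) ?unit_homs0//= (bigD1 k) ?hk//= (bigD1 (- k)) ?hNk ?Nk0//=.
have nonneg : 0 <= #|unit_homs|%:R *
   (\sum_(1 <= i < n.+1 | (i%:R : 'Z_M) == 1) vonMangoldt i / i%:R) :> R.
  rewrite mulr_ge0//; apply: sumr_ge0 => i _; rewrite divr_ge0//.
  exact: vonMangoldt_ge0.
have H1 : complex.Re (chi_vonMangoldt (dchar 0) n) <= ln n%:R + 4.
  rewrite principal_vonMangoldt/=; apply: le_trans (mertens_upper n0).
  rewrite big_mkcond; apply: ler_sum => i _; case: ifP => // _.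
  by rewrite divr_ge0// vonMangoldt_ge0.
have H2 := zero_dchar_vonMangoldt hk k0 H n0.
have H3 := zero_dchar_vonMangoldt hNk Nk0 HN n0.
have H4 : \sum_(i | (i \in unit_homs) && (i != 0) && (i != k) && (i != - k))
   complex.Re (chi_vonMangoldt (dchar i) n) <= rest.
  by apply: ler_sum => l /andP[/andP[/andP[hl l0] _] _]; exact: HK.
move=> E; rewrite -E in nonneg; lra.
Qed.

Lemma dirichlet_residue_unbounded (a : 'Z_M) (K : R) : a \is a GRing.unit ->
  exists n, K < \sum_(1 <= i < n.+1 | (i%:R : 'Z_M) == a) vonMangoldt i / i%:R.
Proof.
move=> ua.
have /boolp.choice[B HB] : forall l : {ffun gT -> 'Z_N}, exists b : R,
    l \in unit_homs -> l != 0 ->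
    forall n, cabs (chi_vonMangoldt (dchar l) n) <= b.
  move=> l.
  have [hl|] := boolP (l \in unit_homs); last by exists 0.
  have [->|l0] := eqVneq l 0; first by exists 0.
  by have [/(dchar_nonvanishing hl l0)//|[L HL]] := dchar_vonMangoldt_cases hl l0; exists L.
pose rest := \sum_(l in unit_homs | l != 0) B l.
(* The loss in passing from all integers to those prime to M: a prime not coprime to M divides it,
   hence is at most M. *)
pose D : R := \sum_(1 <= p < M.+1) ln p%:R / p%:R + 2.
pose h : R := #|unit_homs|%:R.
have h0 : 0 < h by rewrite ltr0n; apply/card_gt0P; exists 0; exact: unit_homs0.
have [n n0 Hn] := ln_nat_unbounded (1 + D + rest + h * K).
exists n; rewrite -(ltr_pM2l h0).
have := sum_homs_vonMangoldt n ua.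
rewrite (bigD1 (0 : {ffun gT -> 'Z_N})) ?unit_homs0//= zchar_trivial unitrV ua mul1r principal_vonMangoldt.
set S := \sum_(1 <= i < n.+1 | _ == a) _.
set T0 := \sum_(1 <= i < n.+1 | coprime i M) _.
set E := bigop _ _ _ => H.
have HS : real_complex R (h * S) = real_complex R T0 + E := esym H.
have H1 : T0 - h * S <= rest.
  apply: le_trans (ler_norm _) _; rewrite -cabs_real.
  have -> : (T0 - h * S)%:C%C = - E :> R[i].
    transitivity (T0%:C%C - (h * S)%:C%C : R[i]); first exact: rmorphB.
    by rewrite HS opprD addrA subrr sub0r.
  rewrite cabsN.
  apply: le_trans (ler_cabs_sum _ _ _) _; apply: ler_sum => l /andP[hl l0].
  rewrite cabsM cabs_zchar unitrV ua mul1r; exact: HB.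
have H2 : ln n%:R - 1 <= T0 + D.
  apply: le_trans (mertens_lower n0) _.
  rewrite (bigID (fun i => coprime i M))/= lerD2l.
  apply: sum_vonMangoldt_bounded => p pp; rewrite prime_coprime// negbK => pM.
  by apply: dvdn_leq pM; exact: ltnW.
rewrite -/h -/S; move: H1 H2 Hn; rewrite -/D; set hS := h * S; set hK := h * K; lra.
Qed.

Lemma dirichlet_residue (a : 'Z_M) (B : nat) : a \is a GRing.unit ->
  exists p, [/\ prime p, (B < p)%N & (p%:R : 'Z_M) = a].
Proof.
move=> ua; apply/not_existsP => H.
have [n] := dirichlet_residue_unbounded (\sum_(1 <= p < B.+1) ln p%:R / p%:R + 2) ua.
rewrite ltNge; case/negP; apply: sum_vonMangoldt_bounded => p pp /eqP pa.
by rewrite leqNgt; apply/negP => Bp; apply: (H p).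
Qed.

End DirichletCharacters.

Theorem dirichlet_primes (R : realType) (a M B : nat) : (0 < M)%N -> coprime a M ->
  exists p, [/\ prime p, (B < p)%N & p = a %[mod M]].
Proof.
(* ['Z_1] is the ring Z/2, so modulus 1 is treated apart; there every prime lies in the class. *)
move=> M0 aM; have [M1|M1] := leqP M 1.
  have [p Bp pp] := prime_above B; exists p; split=> //.
  have -> : M = 1%N by apply/eqP; rewrite eqn_leq M1 M0.
  by rewrite !modn1.
have ua : (a%:R : 'Z_M) \is a GRing.unit by rewrite dchar_unit.
have [p [pp Bp pa]] := @dirichlet_residue R M M1 _ B ua.
exists p; split => //; move/(congr1 val): pa.
by rewrite /= !val_Zp_nat.
Qed.

Theorem dirichlet_primes_int (R : realType) (a : int) (M B : nat) : (0 < M)%N ->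
  coprimez a M%:Z ->
  exists p, [/\ prime p, (B < p)%N & (p%:Z = a %[mod M%:Z])%Z].
Proof.
move=> M0 aM; have M0' : M%:Z != 0 by rewrite gt_eqF.
have a0 : (0 <= a %% M%:Z)%Z by rewrite modz_ge0.
have aE : (`|(a %% M)%Z|%N%:Z = a %% M)%Z by rewrite gez0_abs.
have [|p [pp Bp pa]] := @dirichlet_primes R `|(a %% M)%Z|%N M B M0.
  by rewrite -[coprime _ _]/(coprimez _ M%:Z) /coprimez gcdz_modl.
exists p; split=> //; move/(congr1 Posz): pa.
by rewrite -!modz_nat aE modz_mod.
Qed.

(** * From the torus to finite fields *)

Section Exponential.
Context {R : realType}.
Implicit Types (x y : R) (n m : int).

Lemma cabs_expi2pi x : cabs (expi2pi x) = 1.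
Proof. by rewrite /cabs /expi2pi /= cos2Dsin2 sqrtr1. Qed.

Lemma expi2piD1 x : expi2pi (x + 1) = expi2pi x.
Proof.
rewrite /expi2pi mulrDr mulr1.
have E : (2 : R) * pi = pi *+ 2 by rewrite mulr_natl.
by rewrite !E cosD2pi sinD2pi.
Qed.

Lemma expi2piDn x k : expi2pi (x + k%:R) = expi2pi x.
Proof.
elim: k => [|k IH]; first by rewrite addr0.
by rewrite -natr1 addrA expi2piD1.
Qed.

Lemma expi2piDz x n : expi2pi (x + n%:~R) = expi2pi x.
Proof.
case: n => k; first exact: expi2piDn.
by rewrite NegzE mulrNz -(expi2piDn _ k.+1) subrK.
Qed.

Lemma ler_diff_deriv1 (f df : R -> R) x y :
  (forall u : R, is_derive u (1 : R) f (df u)) -> (forall u, `|df u| <= 1) ->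
  `|f x - f y| <= `|x - y|.
Proof.
move=> fdf df1; wlog xy : x y / y < x.
  move=> H; have [/H//|/H h|->] := ltgtP y x; last by rewrite !subrr normr0.
  by rewrite distrC (distrC x).
have [|c _ ->] := @MVT R f df y x xy (fun u _ => fdf u).
  apply: derivable_within_continuous => u _.
  by apply: ex_derive.
by rewrite normrM -[leRHS]mul1r ler_wpM2r.
Qed.

Lemma cabs_expi2pi_sub x y : cabs (expi2pi x - expi2pi y) <= 4 * pi * `|x - y|.
Proof.
have Hc : `|cos (2 * pi * x) - cos (2 * pi * y)| <= `|2 * pi * x - 2 * pi * y| :> R.
  apply: (@ler_diff_deriv1 _ (fun u => - sin u)) => u.
  by rewrite normrN ler_norml sin_geN1 sin_le1.
have Hs : `|sin (2 * pi * x) - sin (2 * pi * y)| <= `|2 * pi * x - 2 * pi * y| :> R.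
  apply: (@ler_diff_deriv1 _ cos) => u.
  by rewrite ler_norml cos_geN1 cos_le1.
have E : `|2 * pi * x - 2 * pi * y| = 2 * pi * `|x - y| :> R.
  by rewrite -mulrBr normrM ger0_norm// mulr_ge0// pi_ge0.
rewrite E in Hc Hs.
pose a := cos (2 * pi * x) - cos (2 * pi * y).
pose b := sin (2 * pi * x) - sin (2 * pi * y).
have -> : expi2pi x - expi2pi y = Complex a 0 + Complex 0 b.
  by apply/eqP; rewrite eq_complex/= addr0 add0r !eqxx.
apply: le_trans (ler_cabsD _ _) _.
rewrite /cabs /= !expr0n /= addr0 add0r !sqrtr_sqr.
by apply: le_trans (lerD Hc Hs) _; rewrite -mulrDl -mulrDl -natrD.
Qed.

End Exponential.

(** * Reduction of the integer paraboloid modulo p *)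

Section FiniteExtension.
Context {R : realType}.
Variable p : nat.
Hypothesis pp : prime p.

Let p0 : (0 < p)%N := prime_gt0 pp.
Let pR0 : (0 : R) < p%:R. Proof. by rewrite ltr0n. Qed.

Lemma Fp_intr (m : int) : (m%:~R : 'F_p) = (`|(m %% p)%Z|%N)%:R.
Proof.
rewrite {1}(divz_eq m p) rmorphD rmorphM /= -[p%:~R]/(p%:R : 'F_p) pchar_Fp_0// mulr0 add0r.
have m0 : (0 <= m %% p)%Z by rewrite modz_ge0// gt_eqF.
by rewrite -{1}(gez0_abs m0) -pmulrn.
Qed.

Lemma ep_intr (m : int) : ep R (m%:~R : 'F_p) = expi2pi (m%:~R / p%:R).
Proof.
rewrite /ep Fp_intr /= val_Fp_nat// modn_small; last first.
  rewrite -ltz_nat gez0_abs ?modz_ge0 ?gt_eqF//.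
  by rewrite ltz_mod// gt_eqF.
rewrite [in RHS](divz_eq m p) rmorphD rmorphM /= addrC mulrDl mulfK ?gt_eqF//.
rewrite expi2piDz; congr (expi2pi (_ / _)).
have m0 : (0 <= m %% p)%Z by rewrite modz_ge0// gt_eqF.
by rewrite -{2}(gez0_abs m0) -pmulrn.
Qed.

Definition grid (x : 'rV['F_p]_3) : T3 R :=
  ((\val (x ord0 ord0))%:R / p%:R, (\val (x ord0 (inord 1)))%:R / p%:R,
   (\val (x ord0 (inord 2)))%:R / p%:R).

Definition residue2 (n : int * int) : 'rV['F_p]_2 :=
  \row_(i < 2) (if i == ord0 then n.1 else n.2)%:~R.

Definition residue3 (n : int * int) : 'rV['F_p]_3 :=
  row_mx (residue2 n) (dotp (residue2 n) (residue2 n))%:M.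

Lemma residue3_P3 n : residue3 n \in P3 p.
Proof. by apply/imsetP; exists (residue2 n). Qed.

Definition residue_pt n : P3_pt p :=
  exist (fun xi => xi \in P3 p) (residue3 n) (residue3_P3 n).

Lemma dotp_residue2 n : dotp (residue2 n) (residue2 n) = (n.1 ^+ 2 + n.2 ^+ 2)%:~R.
Proof.
by rewrite /dotp big_ord_recl big_ord1 !mxE /= rmorphD/= !rmorphXn/= -!expr2.
Qed.

Lemma dotp_residue3 (x : 'rV['F_p]_3) n :
  dotp x (residue3 n) =
  ((\val (x ord0 ord0))%:Z * n.1 + (\val (x ord0 (inord 1)))%:Z * n.2 +
   (\val (x ord0 (inord 2)))%:Z * (n.1 ^+ 2 + n.2 ^+ 2))%:~R.
Proof.
rewrite /dotp !big_ord_recl big_ord0 addr0 addrA.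
(* The row is a block of size 2 + 1, while [grid] reads its argument at indices of ['I_3]; these
   equations match the two. *)
have E0 : ord0 = lshift 1 (ord0 : 'I_2) :> 'I_3 by apply: val_inj.
have E1 : lift ord0 ord0 = lshift 1 (lift ord0 ord0 : 'I_2) :> 'I_3 by apply: val_inj.
have E2 : lift ord0 (lift ord0 ord0) = rshift 2 (ord0 : 'I_1) :> 'I_3 by apply: val_inj.
have I1 : lift ord0 ord0 = inord 1 :> 'I_3 by apply: val_inj; rewrite /= inordK.
have I2 : lift ord0 (lift ord0 ord0) = inord 2 :> 'I_3 by apply: val_inj; rewrite /= inordK.
have r0 : residue3 n ord0 ord0 = n.1%:~R by rewrite E0; apply: etrans (row_mxEl _ _ _ _) _; rewrite mxE.
have r1 : residue3 n ord0 (lift ord0 ord0) = n.2%:~R.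
  by rewrite E1; apply: etrans (row_mxEl _ _ _ _) _; rewrite mxE.
have r2 : residue3 n ord0 (lift ord0 (lift ord0 ord0)) = (n.1 ^+ 2 + n.2 ^+ 2)%:~R.
  by rewrite E2; apply: etrans (row_mxEr _ _ _ _) _; rewrite mxE dotp_residue2 mulr1n.
rewrite r0 r1 r2 -I1 -I2.
have nz (y : 'F_p) : (\val y)%:Z%:~R = y by rewrite -pmulrn; exact: natr_Zp.
move: (n.1 ^+ 2 + n.2 ^+ 2) => q.
by rewrite !rmorphD !rmorphM /= !nz.
Qed.

Lemma ep_residue3 (x : 'rV['F_p]_3) n :
  ep R (dotp x (residue3 n)) = character (lift_paraboloid n) (grid x).
Proof.
rewrite dotp_residue3 ep_intr /=; congr expi2pi.
rewrite !rmorphD !rmorphM /= -!pmulrn; field.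
by rewrite gt_eqF.
Qed.

End FiniteExtension.

Section Transference.
Context {R : realType}.
Variables (I : finType) (n : I -> int * int) (c : I -> R[i]).
Hypothesis n_inj : injective n.

Definition trig_poly (t : T3 R) : R[i] :=
  \sum_i c i * character (lift_paraboloid (n i)) t.

Definition l2mass : R := \sum_i cabs (c i) ^+ 2.

Lemma l2mass_ge0 : 0 <= l2mass.
Proof. by apply: sumr_ge0 => i _; rewrite exprn_ge0// cabs_ge0. Qed.

(** The push-forward of c under reduction mod p. Summing over fibres makes the formula for the
    extension valid for every prime; injectivity enters only in the L^2 norm. *)
Definition grid_coef (p : nat) (xi : P3_pt p) : R[i] :=
  \sum_(i | val xi == residue3 p (n i)) c i.

Lemma extension_grid_coef (p : nat) (x : 'rV['F_p]_3) : prime p ->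
  extension (@grid_coef p) x = (p%:R ^+ 2)^-1 * trig_poly (grid x).
Proof.
move=> pp; rewrite /extension; congr (_ * _).
under eq_bigr do rewrite /grid_coef mulr_suml.
rewrite (exchange_big_dep xpredT)//=; apply: eq_bigr => i _.
rewrite -ep_residue3//.
rewrite (bigD1 (residue_pt p (n i)))//= big1 ?addr0//.
move=> xi /andP[/eqP E]; case/negP; apply/eqP; exact: val_inj.
Qed.

(** Two coordinates of absolute value below p/2 differ by less than p, so they agree once they are
    congruent; the first two entries determine the point. *)
Lemma residue3_inj (p : nat) : prime p ->
  (forall i, 2 * `|(n i).1| < p /\ 2 * `|(n i).2| < p)%N ->
  injective (fun i => residue3 p (n i)).
Proof.
move=> pp small i j; move=> Eij.
have [E _] := @eq_row_mx _ 1 2 1 _ _ _ _ Eij.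
have H (a b : int) : (2 * `|a| < p)%N -> (2 * `|b| < p)%N ->
    (a%:~R = b%:~R :> 'F_p) -> a = b.
  move=> ap bp /eqP; rewrite -subr_eq0 -rmorphB /= Fp_intr//.
  move/eqP/(congr1 val); rewrite /= val_Fp_nat// => /eqP.
  have p0 := prime_gt0 pp.
  have m0 : (0 <= (a - b)%R %% p)%Z by rewrite modz_ge0// gt_eqF.
  have mp : ((a - b)%R %% p < p)%Z by rewrite ltz_mod// gt_eqF.
  have [k] : exists k : int, a - b = k * p + ((a - b)%R %% p)%Z.
    by exists ((a - b)%R %/ p)%Z; rewrite -divz_eq.
  rewrite modn_small; last by rewrite -ltz_nat gez0_abs.
  move=> Ek /eqP/eqP; rewrite absz_eq0 => /eqP z; rewrite z addr0 in Ek.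
  have [k0|k0] := eqVneq k 0.
    by move: Ek; rewrite k0 mul0r => /eqP; rewrite subr_eq0 => /eqP.
  have : (`|a - b| = `|k| * p)%N by rewrite Ek abszM.
  have : (0 < `|k|)%N by rewrite absz_gt0.
  have := leqD_dist a 0 b; rewrite subr0 sub0r abszN.
  nia.
have [p1 p2] := (small i); have [q1 q2] := small j.
apply: n_inj; rewrite (surjective_pairing (n i)) (surjective_pairing (n j)).
have /rowP E' := E.
congr pair; apply: H => //.
  by have := E' ord0; rewrite !mxE.
by have := E' ord_max; rewrite !mxE.
Qed.

Lemma L2_grid_coef (p : nat) : prime p ->
  injective (fun i => residue3 p (n i)) ->
  \sum_(xi : P3_pt p) cabs (grid_coef xi) ^+ 2 = l2mass.
Proof.
move=> pp inj; rewrite /l2mass.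
rewrite (partition_big (fun i => residue_pt p (n i)) xpredT)//=.
apply: eq_bigr => xi _; rewrite /grid_coef.
have E i : (val xi == residue3 p (n i)) = (residue_pt p (n i) == xi).
  by rewrite eq_sym -val_eqE.
rewrite (eq_bigl _ _ E).
have [j /eqP Ej|none] := pickP (fun i => residue_pt p (n i) == xi).
  have one i : (residue_pt p (n i) == xi) = (i == j).
    rewrite -Ej -val_eqE /=; apply/eqP/eqP => [/inj//|->//].
  by rewrite !(eq_bigl _ _ one) !big_pred1_eq.
by rewrite !big_pred0// cabs0 expr0n.
Qed.

Variables (C : R) (p : nat).
Hypothesis pp : prime p.
Hypothesis residue_inj : injective (fun i => residue3 p (n i)).
Hypothesis ext : forall f : P3_pt p -> R[i], L3norm_Fp3 (extension f) <= C * L2norm_P3 f.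

Lemma grid_sum_le :
  \sum_(x : 'rV['F_p]_3) cabs (trig_poly (grid x)) ^+ 3 <=
  p%:R ^+ 3 * (`|C| * l2mass `^ 2^-1) ^+ 3.
Proof.
have pR0 : (0 : R) < p%:R by rewrite ltr0n prime_gt0.
have := ext (@grid_coef p).
rewrite /L3norm_Fp3 /L2norm_P3 L2_grid_coef//.
under eq_bigr => x _ do rewrite extension_grid_coef// cabsM exprMn.
rewrite -mulr_sumr; set S := \sum_x _.
have S0 : 0 <= S by apply: sumr_ge0 => x _; rewrite exprn_ge0// cabs_ge0.
have -> : cabs (p%:R ^+ 2)^-1 = (p%:R ^+ 2)^-1 :> R.
  by rewrite cabsV cabsX cabs_nat.
rewrite [(_ * l2mass) `^ _]powRM ?invr_ge0 ?exprn_ge0 ?l2mass_ge0 ?(ltW pR0)//.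
have -> : (p%:R ^+ 2)^-1 `^ 2^-1 = p%:R^-1 :> R.
  rewrite -exprVn -powR_mulrn ?invr_ge0 ?(ltW pR0)// -powRrM mulfV// powRr1// invr_ge0 ltW.
move=> H.
(* The sign of C is not known; with its absolute value the right-hand side is non-negative and the
   inequality can be cubed. *)
have H' : ((p%:R ^+ 2)^-1 ^+ 3 * S) `^ 3^-1 <= p%:R^-1 * (`|C| * l2mass `^ 2^-1).
  apply: le_trans H _; rewrite mulrCA ler_wpM2l ?invr_ge0 ?(ltW pR0)//.
  by rewrite ler_wpM2r ?powR_ge0// ler_norm.
have {H'} : (p%:R ^+ 2)^-1 ^+ 3 * S <= (p%:R^-1 * (`|C| * l2mass `^ 2^-1)) ^+ 3.
  have T0 : 0 <= (p%:R ^+ 2)^-1 ^+ 3 * S.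
    by rewrite mulr_ge0// exprn_ge0// invr_ge0 exprn_ge0// ltW.
  have -> : (p%:R ^+ 2)^-1 ^+ 3 * S = (((p%:R ^+ 2)^-1 ^+ 3 * S) `^ 3^-1) ^+ 3.
    by rewrite -powR_mulrn ?powR_ge0// -powRrM mulVf// powRr1.
  by rewrite lerXn2r ?nnegrE ?powR_ge0// mulr_ge0 ?invr_ge0 ?(ltW pR0)// mulr_ge0 ?powR_ge0.
rewrite exprMn => H3.
have -> : S = p%:R ^+ 6 * ((p%:R ^+ 2)^-1 ^+ 3 * S).
  by field; rewrite gt_eqF.
have -> : p%:R ^+ 3 * (`|C| * l2mass `^ 2^-1) ^+ 3 =
    p%:R ^+ 6 * (p%:R^-1 ^+ 3 * (`|C| * l2mass `^ 2^-1) ^+ 3).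
  by field; rewrite gt_eqF.
by rewrite ler_wpM2l// exprn_ge0// ltW.
Qed.

End Transference.

(** * Measure on the torus *)

Section TorusMeasure.
Context {R : realType}.
Local Open Scope classical_set_scope.

Lemma unif01_itv (a b : R) : 0 <= a -> a <= b -> b <= 1 ->
  unif01 R `[a, b[ = (b - a)%:E.
Proof.
move=> a0 ab b1; rewrite /unif01 /= /uniform_prob integral_uniform_pdf.
rewrite setIidl; last first.
  by move=> x /=; rewrite !in_itv/= => /andP[ax /ltW xb]; rewrite (le_trans a0 ax) (le_trans xb b1).
rewrite (eq_integral (fun=> 1%:E)); last first.
  move=> x; rewrite inE/= in_itv/= /uniform_pdf => /andP[ax /ltW xb].
  by rewrite (le_trans a0 ax) (le_trans xb b1) subr0 invr1.
rewrite integral_cst//= mul1e lebesgue_measure_itv/= lte_fin.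
case: ltP => // ba; have -> : a = b by apply/eqP; rewrite eq_le ab ba.
by rewrite subrr.
Qed.

Lemma haarT3_box (A B D : set (measurableTypeR R)) :
  measurable A -> measurable B -> measurable D ->
  haarT3 R ((A `*` B) `*` D) = (unif01 R A * unif01 R B * unif01 R D)%E.
Proof.
move=> mA mB mD; rewrite /haarT3 /= product_measure1E//; last exact: measurableX.
congr (_ * _)%E; exact: product_measure1E.
Qed.

Lemma haarT3_setT : haarT3 R setT = 1%E.
Proof.
rewrite -setXTT -setXTT haarT3_box// !probability_setT.
by rewrite !mule1.
Qed.

(** Half-open, so that it is cut into the half-open boxes [grid_box]; [haarT3] is a measure on R^3
    concentrated on it. *)
Definition unit_cube : set (T3 R) := (`[0, 1[ `*` `[0, 1[) `*` `[0, 1[.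

Lemma measurable_unit_cube : measurable unit_cube.
Proof. by apply: measurableX => //; apply: measurableX. Qed.

Lemma haarT3_unit_cube : haarT3 R unit_cube = 1%E.
Proof. by rewrite haarT3_box// unif01_itv// subr0 !mule1. Qed.

Lemma ae_unit_cube : {ae haarT3 R, forall t, unit_cube t}.
Proof.
exists (~` unit_cube); split=> //; first exact: measurableC measurable_unit_cube.
have H := measureU (haarT3 R) measurable_unit_cube
  (measurableC measurable_unit_cube) (setICr unit_cube).
have H1 : haarT3 R (unit_cube `|` ~` unit_cube) = 1%E.
  by rewrite setUCr; exact: haarT3_setT.
have {H H1} H : (1 = 1 + haarT3 R (~` unit_cube))%E.
  apply: etrans (esym H1) _; apply: etrans H _.
  by congr (_ + _)%E; exact: haarT3_unit_cube.
suff : haarT3 R (~` unit_cube) = 0%E by [].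
case: (haarT3 R (~` unit_cube)) H => [r||]//.
by rewrite -EFinD => -[] H; congr EFin; lra.
Qed.

Lemma cmeasurable_character (g : int * int * int) : cmeasurable (@character R g).
Proof.
have mph : measurable_fun setT
    (fun t : T3 R => 2 * pi * (g.1.1%:~R * t.1.1 + g.1.2%:~R * t.1.2 + g.2%:~R * t.2) : R).
  apply: measurable_funM => //; apply: measurable_funD; first apply: measurable_funD.
  - apply: measurable_funM => //; exact: measurableT_comp.
  - apply: measurable_funM => //; exact: measurableT_comp.
  - exact: measurable_funM.
have E (t : T3 R) : character g t =
    expi2pi (g.1.1%:~R * t.1.1 + g.1.2%:~R * t.1.2 + g.2%:~R * t.2).
  by clear mph; case: g t => [[? ?] ?] [[? ?] ?].
split.
  rewrite (_ : (fun t => _) = cos \o (fun t : T3 R => 2 * pi *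
    (g.1.1%:~R * t.1.1 + g.1.2%:~R * t.1.2 + g.2%:~R * t.2))); last first.
    by apply/funext => t; rewrite E.
  apply: measurableT_comp mph; apply: continuous_measurable_fun.
  by move=> x; exact: continuous_cos.
rewrite (_ : (fun t => _) = sin \o (fun t : T3 R => 2 * pi *
  (g.1.1%:~R * t.1.1 + g.1.2%:~R * t.1.2 + g.2%:~R * t.2))); last first.
  by apply/funext => t; rewrite E.
apply: measurableT_comp mph; apply: continuous_measurable_fun.
by move=> x; exact: continuous_sin.
Qed.

Lemma cmeasurable_cst (z : R[i]) : cmeasurable (fun=> z).
Proof. by split. Qed.

Lemma cmeasurableD (F G : T3 R -> R[i]) : cmeasurable F -> cmeasurable G ->
  cmeasurable (fun t => F t + G t).
Proof.
move=> [F1 F2] [G1 G2]; split.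
  by under eq_fun do rewrite raddfD; exact: measurable_funD.
by under eq_fun do rewrite raddfD; exact: measurable_funD.
Qed.

Lemma cmeasurableM (F G : T3 R -> R[i]) : cmeasurable F -> cmeasurable G ->
  cmeasurable (fun t => F t * G t).
Proof.
move=> [F1 F2] [G1 G2]; split.
  rewrite (_ : (fun t => _) = (fun t => complex.Re (F t) * complex.Re (G t) -
      complex.Im (F t) * complex.Im (G t))); last first.
    by apply/funext => t; case: (F t); case: (G t).
  by apply: measurable_funB; apply: measurable_funM.
rewrite (_ : (fun t => _) = (fun t => complex.Re (F t) * complex.Im (G t) +
    complex.Im (F t) * complex.Re (G t))); last first.
  by apply/funext => t; case: (F t) => ? ?; case: (G t).
by apply: measurable_funD; apply: measurable_funM.
Qed.

Lemma cmeasurableB (F G : T3 R -> R[i]) : cmeasurable F -> cmeasurable G ->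
  cmeasurable (fun t => F t - G t).
Proof.
move=> mF mG; rewrite (_ : (fun t => _) = (fun t => F t + (-1) * G t)).
  by apply: cmeasurableD => //; apply: cmeasurableM => //; exact: cmeasurable_cst.
by apply/funext => t; rewrite mulN1r.
Qed.

Lemma cmeasurable_sum (I : Type) (r : seq I) (F : I -> T3 R -> R[i]) :
  (forall i, cmeasurable (F i)) -> cmeasurable (fun t => \sum_(i <- r) F i t).
Proof.
move=> mF; elim: r => [|i r IH].
  by under eq_fun do rewrite big_nil; exact: cmeasurable_cst.
by under eq_fun do rewrite big_cons; exact: cmeasurableD.
Qed.

Lemma measurable_cabs (F : T3 R -> R[i]) : cmeasurable F ->
  measurable_fun setT (fun t => cabs (F t)).
Proof.
move=> [F1 F2].
rewrite (_ : (fun t => _) = Num.sqrt \o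
   (fun t => complex.Re (F t) ^+ 2 + complex.Im (F t) ^+ 2)); last first.
  by apply/funext => t; rewrite /cabs /=; case: (F t).
apply: measurableT_comp.
  by apply: continuous_measurable_fun; exact: sqrt_continuous.
by apply: measurable_funD; apply: measurable_funX.
Qed.

Lemma measurable_cabsX (F : T3 R -> R[i]) n : cmeasurable F ->
  measurable_fun setT (fun t => (cabs (F t) ^+ n)%:E).
Proof.
move=> mF; apply/measurable_EFinP; apply: measurable_funX.
exact: measurable_cabs.
Qed.

Lemma LnormT3E (n : nat) (F : T3 R -> R[i]) :
  LnormT3 (n.+1%:R : R) F =
  ((\int[haarT3 R]_t (cabs (F t) ^+ n.+1)%:E) `^ (n.+1%:R^-1))%E.
Proof.
rewrite /LnormT3 unlock; congr (_ `^ _)%E; apply: eq_integral => t _ /=.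
by rewrite ger0_norm ?cabs_ge0// powR_mulrn// cabs_ge0.
Qed.

End TorusMeasure.

(** * Comparison of the integral with Riemann sums *)

Section TrigPolyBounds.
Context {R : realType}.
Variables (I : finType) (n : I -> int * int) (c : I -> R[i]).
Local Notation T := (trig_poly n c).

Definition l1mass : R := \sum_i cabs (c i).

(** A Lipschitz constant of the trigonometric polynomial for the sup distance; 4 pi is 2 pi for the
    cosine plus 2 pi for the sine. *)
Definition lipschitz_mass : R := \sum_i cabs (c i) * (4 * pi *
  (`|(n i).1%:~R| + `|(n i).2%:~R| + `|((n i).1 ^+ 2 + (n i).2 ^+ 2)%:~R|)).

Lemma l1mass_ge0 : 0 <= l1mass.
Proof. by apply: sumr_ge0 => i _; exact: cabs_ge0. Qed.

Lemma lipschitz_mass_ge0 : 0 <= lipschitz_mass.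
Proof.
apply: sumr_ge0 => i _; rewrite mulr_ge0 ?cabs_ge0// mulr_ge0//.
by rewrite mulr_ge0// pi_ge0.
Qed.

Lemma cabs_character (g : int * int * int) (t : T3 R) : cabs (character g t) = 1.
Proof. by case: g t => [[? ?] ?] [[? ?] ?]; exact: cabs_expi2pi. Qed.

Lemma cabs_trig_poly_le t : cabs (T t) <= l1mass.
Proof.
apply: le_trans (ler_cabs_sum _ _ _) _; apply: ler_sum => i _.
by rewrite cabsM cabs_character mulr1.
Qed.

Lemma cabs_character_sub (g : int * int * int) (s t : T3 R) (d : R) :
  `|s.1.1 - t.1.1| <= d -> `|s.1.2 - t.1.2| <= d -> `|s.2 - t.2| <= d ->
  cabs (character g s - character g t) <=
    4 * pi * (`|g.1.1%:~R| + `|g.1.2%:~R| + `|g.2%:~R|) * d.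
Proof.
case: g s t => [[a b] e] [[s1 s2] s3] [[t1 t2] t3] /= H1 H2 H3.
apply: le_trans (cabs_expi2pi_sub _ _) _.
rewrite -[leRHS]mulrA ler_wpM2l ?mulr_ge0 ?pi_ge0//.
have -> : a%:~R * s1 + b%:~R * s2 + e%:~R * s3 - (a%:~R * t1 + b%:~R * t2 + e%:~R * t3) =
  a%:~R * (s1 - t1) + b%:~R * (s2 - t2) + e%:~R * (s3 - t3) by ring.
rewrite !mulrDl; apply: le_trans (ler_normD _ _) _; apply: lerD.
  apply: le_trans (ler_normD _ _) _; apply: lerD.
    by rewrite normrM ler_wpM2l.
  by rewrite normrM ler_wpM2l.
by rewrite normrM ler_wpM2l.
Qed.

Lemma cabs_trig_poly_sub (s t : T3 R) (d : R) :
  `|s.1.1 - t.1.1| <= d -> `|s.1.2 - t.1.2| <= d -> `|s.2 - t.2| <= d ->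
  cabs (T s - T t) <= lipschitz_mass * d.
Proof.
move=> H1 H2 H3; rewrite /trig_poly -sumrB.
apply: le_trans (ler_cabs_sum _ _ _) _; rewrite mulr_suml.
apply: ler_sum => i _; rewrite -mulrBr cabsM -mulrA ler_wpM2l ?cabs_ge0//.
exact: cabs_character_sub.
Qed.

(** From a^3 - b^3 = (a - b) (a^2 + a b + b^2), where both moduli are at most [l1mass]. *)
Lemma cabs3_trig_poly_sub (s t : T3 R) (d : R) :
  `|s.1.1 - t.1.1| <= d -> `|s.1.2 - t.1.2| <= d -> `|s.2 - t.2| <= d ->
  cabs (T s) ^+ 3 <= cabs (T t) ^+ 3 + 3 * l1mass ^+ 2 * lipschitz_mass * d.
Proof.
move=> H1 H2 H3; have d0 : 0 <= d := le_trans (normr_ge0 _) H1.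
have H : cabs (T s) - cabs (T t) <= lipschitz_mass * d.
  by apply: le_trans (lerB_cabs _ _) _; exact: cabs_trig_poly_sub.
have := cabs_trig_poly_le s; have := cabs_trig_poly_le t.
have := cabs_ge0 (T s); have := cabs_ge0 (T t).
move: (cabs (T s)) (cabs (T t)) H => a b H b0 a0 bA aA.
have e0 : 0 <= lipschitz_mass * d by rewrite mulr_ge0// lipschitz_mass_ge0.
rewrite -mulrA; move: (lipschitz_mass * d) H e0 => e H e0.
have A0 := l1mass_ge0; move: l1mass aA bA A0 => A aA bA A0.
have Q0 : 0 <= 3 * A ^+ 2 * e by rewrite !mulr_ge0// exprn_ge0.
have [ab|ba] := leP a b.
  have : a ^+ 3 <= b ^+ 3 by rewrite lerXn2r.
  lra.
have -> : a ^+ 3 = b ^+ 3 + (a - b) * (a * a + a * b + b * b) by ring.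
rewrite lerD2l [leRHS]mulrC; apply: ler_pM => //; first by rewrite subr_ge0 ltW.
  by rewrite !addr_ge0// mulr_ge0.
have -> : 3 * A ^+ 2 = A * A + A * A + A * A by ring.
by rewrite !lerD// ler_pM.
Qed.

End TrigPolyBounds.

Section StepFunctions.
Context {R : realType}.
Variables (I : finType) (n : I -> int * int) (c : I -> R[i]).
Variable p : nat.
Hypothesis pp : prime p.
Local Notation T := (trig_poly n c).
Local Open Scope classical_set_scope.

Let p0 : (0 < p)%N := prime_gt0 pp.
Let pR0 : (0 : R) < p%:R. Proof. by rewrite ltr0n. Qed.

Definition grid_itv (k : 'F_p) : set (measurableTypeR R) :=
  `[(\val k)%:R / p%:R, ((\val k).+1)%:R / p%:R[.

Definition grid_box (x : 'rV['F_p]_3) : set (T3 R) :=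
  (grid_itv (x ord0 ord0) `*` grid_itv (x ord0 (inord 1))) `*` grid_itv (x ord0 (inord 2)).

Lemma unif01_grid_itv (k : 'F_p) : unif01 R (grid_itv k) = (p%:R^-1)%:E.
Proof.
rewrite unif01_itv.
- by rewrite -mulrBl -natr1 addrAC subrr add0r mul1r.
- by rewrite divr_ge0.
- by rewrite ler_pM2r ?invr_gt0// ler_nat.
- rewrite ler_pdivrMr// mul1r ler_nat.
  by rewrite -[X in (_ <= X)%N](Fp_cast pp) ltn_ord.
Qed.

Lemma measurable_grid_box x : measurable (grid_box x).
Proof. by apply: measurableX; [apply: measurableX|]; exact: measurable_itv. Qed.

Lemma haarT3_grid_box x : haarT3 R (grid_box x) = ((p%:R ^+ 3)^-1)%:E.
Proof.
rewrite haarT3_box//; try exact: measurable_itv.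
rewrite !unif01_grid_itv -!EFinM; congr EFin.
by field; rewrite gt_eqF.
Qed.

Lemma grid_itv_exists (u : R) : 0 <= u -> u < 1 -> exists k : 'F_p, grid_itv k u.
Proof.
move=> u0 u1; pose k := Num.truncn (p%:R * u).
have pu0 : 0 <= p%:R * u by rewrite mulr_ge0.
have /andP[k1 k2] := truncn_itv pu0; rewrite -/k in k1 k2.
have kp : (k < p)%N.
  by rewrite -(ltr_nat R) (le_lt_trans k1)// -[ltRHS]mulr1 ltr_pM2l.
exists (k%:R : 'F_p); rewrite /grid_itv /= in_itv/= val_Fp_nat// modn_small//.
by rewrite ler_pdivrMr// ltr_pdivlMr// mulrC k1 k2.
Qed.

Lemma grid_box_exists (t : T3 R) : unit_cube t -> exists x, grid_box x t.
Proof.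
case: t => [[t1 t2] t3] [[/= ]]; rewrite !in_itv/= => /andP[a1 b1] /andP[a2 b2] /andP[a3 b3].
have [k1 H1] := grid_itv_exists a1 b1.
have [k2 H2] := grid_itv_exists a2 b2.
have [k3 H3] := grid_itv_exists a3 b3.
exists (\row_(j < 3) (if j == ord0 then k1 else if j == inord 1 then k2 else k3)).
have E1 : (inord 1 : 'I_3) == ord0 = false by rewrite -val_eqE /= inordK.
have E2 : (inord 2 : 'I_3) == ord0 = false by rewrite -val_eqE /= inordK.
have E3 : (inord 2 : 'I_3) == inord 1 = false by rewrite -val_eqE /= !inordK.
by rewrite /grid_box !mxE eqxx E1 eqxx E2 E3.
Qed.

Lemma grid_itv_close (k : 'F_p) (u : R) : grid_itv k u ->
  `|u - (\val k)%:R / p%:R| <= p%:R^-1.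
Proof.
rewrite /grid_itv /= in_itv/= => /andP[H1 H2].
rewrite ger0_norm ?subr_ge0// lerBlDr; apply: le_trans (ltW H2) _.
by rewrite -natr1 mulrDl mul1r addrC.
Qed.

(** The step function whose integral is the Riemann sum of |T|^3 over the grid. *)
Definition grid_step (t : T3 R) : R :=
  \sum_(x : 'rV['F_p]_3) cabs (T (grid x)) ^+ 3 * \1_(grid_box x) t.

Lemma grid_step_ge0 t : 0 <= grid_step t.
Proof.
by apply: sumr_ge0 => x _; rewrite mulr_ge0// exprn_ge0// cabs_ge0.
Qed.

Lemma measurable_grid_step : measurable_fun setT grid_step.
Proof.
apply: measurable_sum => x; apply: measurable_funM => //.
by apply: measurable_indic; exact: measurable_grid_box.
Qed.

Lemma integral_grid_step :
  (\int[haarT3 R]_t (grid_step t)%:E =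
   ((\sum_(x : 'rV['F_p]_3) cabs (T (grid x)) ^+ 3) / p%:R ^+ 3)%:E)%E.
Proof.
under eq_integral do rewrite /grid_step -sumEFin.
rewrite ge0_integral_sum//; first last.
- by move=> x t _; rewrite lee_fin mulr_ge0// exprn_ge0// cabs_ge0.
- move=> x; apply/measurable_EFinP; apply: measurable_funM => //.
  by apply: measurable_indic; exact: measurable_grid_box.
rewrite mulr_suml -sumEFin; apply: eq_bigr => x _.
under eq_integral do rewrite EFinM.
rewrite ge0_integralZl//; first last.
- by rewrite lee_fin exprn_ge0// cabs_ge0.
- by apply/measurable_EFinP; apply: measurable_indic; exact: measurable_grid_box.
rewrite integral_indic//; last exact: measurable_grid_box.
by rewrite setIT haarT3_grid_box EFinM.
Qed.

Lemma cabs3_le_grid_step t : unit_cube t ->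
  cabs (T t) ^+ 3 <=
  grid_step t + 3 * l1mass c ^+ 2 * lipschitz_mass n c * p%:R^-1.
Proof.
move=> /grid_box_exists[x [[/= x1 x2] x3]].
have H := @cabs3_trig_poly_sub R I n c t (grid x) p%:R^-1 (grid_itv_close x1)
  (grid_itv_close x2) (grid_itv_close x3).
apply: le_trans H _.
rewrite lerD2r /grid_step (bigD1 x)//= indicE mem_set ?mulr1; last by split.
by rewrite lerDl; apply: sumr_ge0 => y _; rewrite mulr_ge0// exprn_ge0// cabs_ge0.
Qed.

Lemma cmeasurable_trig_poly : cmeasurable T.
Proof.
apply: cmeasurable_sum => i; apply: cmeasurableM; first exact: cmeasurable_cst.
exact: cmeasurable_character.
Qed.

(** The pointwise comparison with the step function is available on the unit cube only, hence almost
    everywhere; as the total mass is 1 its error passes unchanged to the integral. *)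
Lemma integral_trig_poly_le (K : R) :
  \sum_(x : 'rV['F_p]_3) cabs (T (grid x)) ^+ 3 <= p%:R ^+ 3 * K ->
  (\int[haarT3 R]_t (cabs (T t) ^+ 3)%:E <=
   (K + 3 * l1mass c ^+ 2 * lipschitz_mass n c * p%:R^-1)%:E)%E.
Proof.
move=> HK; set E := 3 * _ * _ * _.
have E0 : 0 <= E.
  by rewrite /E !mulr_ge0// ?exprn_ge0 ?l1mass_ge0 ?lipschitz_mass_ge0// invr_ge0.
have mstep : measurable_fun setT (fun t : T3 R => (grid_step t)%:E).
  by apply/measurable_EFinP; exact: measurable_grid_step.
apply: (@le_trans _ _ (\int[haarT3 R]_t ((grid_step t)%:E + E%:E))%E).
  apply: ae_ge0_le_integral => //.
  - by move=> t _; rewrite lee_fin exprn_ge0// cabs_ge0.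
  - exact: measurable_cabsX cmeasurable_trig_poly.
  - by move=> t _; rewrite -EFinD lee_fin addr_ge0// grid_step_ge0.
  - by under eq_fun do rewrite -EFinD; apply/measurable_EFinP;
      apply: measurable_funD => //; exact: measurable_grid_step.
  - apply: filterS ae_unit_cube => t tU _.
    by rewrite -EFinD lee_fin; exact: cabs3_le_grid_step.
rewrite ge0_integralD//; last by move=> t _; rewrite lee_fin grid_step_ge0.
rewrite integral_grid_step integral_cst//.
rewrite [X in (_ * X)%E](_ : _ = 1%E); last exact: haarT3_setT.
rewrite mule1 -EFinD lee_fin lerD2r ler_pdivrMr ?exprn_gt0//.
by rewrite mulrC.
Qed.

End StepFunctions.

(** * The uniform bound *)

Section UniformBound.
Context {R : realType}.
Variable C : R.
Hypothesis ext : forall B : nat, exists p, [/\ prime p, (B < p)%N &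
  forall f : P3_pt p -> R[i], L3norm_Fp3 (extension f) <= C * L2norm_P3 f].

Definition l3bound (m : R) : R := (`|C| * m `^ 2^-1) ^+ 3.

Lemma l3bound_ge0 m : 0 <= l3bound m.
Proof. by rewrite exprn_ge0// mulr_ge0// powR_ge0. Qed.

Lemma l3bound_le m m' : 0 <= m -> m <= m' -> l3bound m <= l3bound m'.
Proof.
move=> m0 mm'; rewrite lerXn2r ?nnegrE ?mulr_ge0 ?powR_ge0//.
by rewrite ler_wpM2l// ge0_ler_powR// nnegrE// (le_trans m0).
Qed.

Lemma trig_poly_L3_le (I : finType) (n : I -> int * int) (c : I -> R[i]) :
  injective n ->
  (\int[haarT3 R]_t (cabs (trig_poly n c t) ^+ 3)%:E <= (l3bound (l2mass c))%:E)%E.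
Proof.
move=> n_inj; apply/lee_addgt0Pr => e e0.
pose E := 3 * l1mass c ^+ 2 * lipschitz_mass n c.
have E0 : 0 <= E.
  by rewrite /E !mulr_ge0// ?exprn_ge0 ?l1mass_ge0 ?lipschitz_mass_ge0.
(* p > B1 makes the discretisation error at most e, and p > B2 makes the frequencies distinct mod
   p. *)
have [B1 HB1] := nat_above (E / e).
pose B2 := (\sum_i (2 * `|(n i).1| + 2 * `|(n i).2|))%N.
have [p [pp pB H]] := ext (B1 + B2).
have small i : (2 * `|(n i).1| < p)%N /\ (2 * `|(n i).2| < p)%N.
  have : (2 * `|(n i).1| + 2 * `|(n i).2| <= B2)%N.
    by rewrite /B2 (bigD1 i)//= leq_addr.
  move: (2 * `|(n i).1|)%N (2 * `|(n i).2|)%N => x y xy.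
  by split; apply: leq_ltn_trans pB; apply: leq_trans (leq_addl _ _);
    apply: leq_trans xy; rewrite ?leq_addr ?leq_addl.
have inj := residue3_inj n_inj pp small.
have K := grid_sum_le c pp inj H.
apply: le_trans (integral_trig_poly_le pp K) _.
rewrite -EFinD lee_fin lerD2l -/E ler_pdivrMr ?ltr0n ?prime_gt0//.
rewrite mulrC -ler_pdivrMr//; apply: le_trans HB1 _.
by rewrite ler_nat ltnW// (leq_ltn_trans _ pB)// leq_addr.
Qed.

Lemma LnormT3_3_le (F : T3 R -> R[i]) (m : R) :
  (\int[haarT3 R]_t (cabs (F t) ^+ 3)%:E <= (l3bound m)%:E)%E ->
  (LnormT3 (3 : R) F <= (`|C| * m `^ 2^-1)%:E)%E.
Proof.
move=> H; rewrite (LnormT3E 2 F).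
have i0 : (0 <= \int[haarT3 R]_t (cabs (F t) ^+ 3)%:E)%E.
  by apply: integral_ge0 => t _; rewrite lee_fin exprn_ge0// cabs_ge0.
apply: (@le_trans _ _ ((l3bound m)%:E `^ 3^-1))%E.
  apply: gt0_ler_poweR => //; rewrite in_itv/= andbC leey//.
  by rewrite lee_fin l3bound_ge0.
rewrite poweR_EFin lee_fin /l3bound.
have c0 : 0 <= `|C| * m `^ 2^-1 by rewrite mulr_ge0// powR_ge0.
by rewrite -powR_mulrn// -powRrM mulfV// powRr1.
Qed.

Lemma finite_sum_L3 (S : {fset int * int}) (c : S -> R[i]) :
  (LnormT3 3%R (fun t : T3 R =>
     \sum_(n : S) c n * character (lift_paraboloid (\val n)) t)%R
   <= (`|C| * (\sum_(n : S) cabs (c n) ^+ 2) `^ 2^-1)%R%:E)%E.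
Proof.
apply: LnormT3_3_le; apply: (@trig_poly_L3_le S (fun n => \val n) c).
exact: val_inj.
Qed.

Local Notation G := integer_paraboloid.

Lemma paraboloid_eq (g : G) : val g = lift_paraboloid (val g).1.
Proof.
case: g => /= g; rewrite in_setE => -[[n1 n2] _ <-] //.
Qed.

Definition fset_mass (a : G -> R[i]) (X : {fset G}) : R :=
  \sum_(g <- X) cabs (a g) ^+ 2.

Lemma fourier_sum_L3_le (a : G -> R[i]) (X : {fset G}) :
  (\int[haarT3 R]_t (cabs (fourier_sum a X t) ^+ 3)%:E <= (l3bound (fset_mass a X))%:E)%E.
Proof.
have inj : injective (fun i : X => (val (val i)).1).
  move=> i j ij; apply: val_inj; apply: val_inj.
  by rewrite (paraboloid_eq (val i)) (paraboloid_eq (val j)) ij.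
have := trig_poly_L3_le (fun i : X => a (val i)) inj.
rewrite /l2mass /trig_poly /fset_mass (big_seq_fsetE _ _ xpredT (fun g => cabs (a g) ^+ 2))/=.
congr (_ <= _)%E; apply: eq_integral => t _.
rewrite /fourier_sum big_seq_fsetE/=; congr (cabs _ ^+ 3)%:E.
apply: eq_bigr => i _; congr (_ * _).
exact: (congr1 (fun g => @character R g t) (esym (paraboloid_eq (fsval i)))).
Qed.

Lemma fset_mass_ge0 a X : 0 <= fset_mass a X.
Proof. by apply: sumr_ge0 => g _; rewrite exprn_ge0// cabs_ge0. Qed.

Lemma fset_mass_le a (X Y : {fset G}) : (X `<=` Y)%fset ->
  fset_mass a X <= fset_mass a Y.
Proof.
move=> XY; rewrite /fset_mass.
have -> : \sum_(g <- X) cabs (a g) ^+ 2 =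
    \sum_(g <- Y) if g \in X then cabs (a g) ^+ 2 else 0.
  rewrite -(big_fset_incl _ XY) => [|g _ /negbTE->//].
  by apply: eq_big_seq => g ->.
apply: ler_sum => g _; case: ifP => // _; by rewrite exprn_ge0// cabs_ge0.
Qed.

(** The difference is itself a Fourier sum, with coefficients supported in the union of X and Y and
    vanishing on Z, so the finite inequality applies to it. This yields the Cauchy property in
    L^3. *)
Lemma fourier_sum_sub_L3_le (a : G -> R[i]) (X Y Z : {fset G}) :
  (Z `<=` X)%fset -> (Z `<=` Y)%fset ->
  (\int[haarT3 R]_t (cabs (fourier_sum a X t - fourier_sum a Y t) ^+ 3)%:E <=
   (l3bound (fset_mass a (X `|` Y)%fset - fset_mass a Z))%:E)%E.
Proof.
move=> ZX ZY.
pose b g : R[i] := (if g \in X then a g else 0) - (if g \in Y then a g else 0).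
have extend (V W : {fset G}) (A : nmodType) (F : G -> A) : (V `<=` W)%fset ->
    \sum_(g <- V) F g = \sum_(g <- W) if g \in V then F g else 0.
  move=> VW; rewrite -(big_fset_incl _ VW) => [|g _ /negbTE->//].
  by apply: eq_big_seq => g ->.
have E t : fourier_sum a X t - fourier_sum a Y t = fourier_sum b (X `|` Y)%fset t.
  rewrite /fourier_sum (extend X (X `|` Y)%fset) ?fsubsetUl//.
  rewrite (extend Y (X `|` Y)%fset) ?fsubsetUr// -sumrB.
  by apply: eq_bigr => g _; rewrite /b mulrBl; case: ifP; case: ifP; rewrite ?mul0r.
under eq_integral do rewrite E.
apply: le_trans (fourier_sum_L3_le _ _) _; rewrite lee_fin.
apply: l3bound_le; first exact: fset_mass_ge0.
rewrite /fset_mass (extend Z (X `|` Y)%fset) ?(fsubset_trans ZX) ?fsubsetUl//.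
rewrite -sumrB; apply: ler_sum => g _; rewrite /b.
case: (boolP (g \in Z)) => gZ.
  by rewrite (fsubsetP ZX)// (fsubsetP ZY)// !subrr cabs0 expr0n.
rewrite subr0; have a0 := cabs_ge0 (a g).
by case: ifP; case: ifP => _ _; rewrite ?subrr ?sub0r ?subr0 ?cabsN ?cabs0 ?expr0n//= exprn_ge0.
Qed.

End UniformBound.

(** * Passage to the limit *)

Section FatouBound.
Context {R : realType}.
Local Open Scope classical_set_scope.

Definition ctends (g : nat -> R[i]) (z : R[i]) : Prop :=
  (fun k => complex.Re (g k)) @ \oo --> complex.Re z /\
  (fun k => complex.Im (g k)) @ \oo --> complex.Im z.

Lemma ctends_sub (g : nat -> R[i]) z w : ctends g z -> ctends (fun k => g k - w) (z - w).
Proof.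
move=> [H1 H2]; split.
  under eq_fun do rewrite raddfB.
  by rewrite raddfB; apply: cvgB => //; exact: cvg_cst.
under eq_fun do rewrite raddfB.
by rewrite raddfB; apply: cvgB => //; exact: cvg_cst.
Qed.

Lemma ctends_shift (g : nat -> R[i]) z j : ctends g z -> ctends (fun k => g (k + j)%N) z.
Proof.
by move=> [H1 H2]; split;
  [have := H1|have := H2]; rewrite -(cvg_shiftn j).
Qed.

Lemma ctends_cabs (g : nat -> R[i]) z : ctends g z ->
  (fun k => cabs (g k)) @ \oo --> cabs z.
Proof.
move=> [H1 H2].
have E (w : R[i]) : cabs w = Num.sqrt (complex.Re w ^+ 2 + complex.Im w ^+ 2) by case: w.
under eq_fun do rewrite E.
rewrite E; apply: (@continuous_cvg _ _ _ _ _ _ Num.sqrt); first exact: sqrt_continuous.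
by rewrite !expr2; apply: cvgD; apply: cvgM.
Qed.

Lemma limn_einf_le (u : (\bar R)^nat) (B : \bar R) : (forall k, (u k <= B)%E) ->
  (limn_einf u <= B)%E.
Proof.
move=> uB; rewrite limn_einf_lim; apply: lime_le; first exact: is_cvg_einfs.
apply: nearW => k; apply: le_trans (uB k).
by apply: ereal_inf_lbound; exists k => /=.
Qed.

Lemma fatou_cabs3 (g : nat -> T3 R -> R[i]) (F : T3 R -> R[i]) (B : R) :
  cmeasurable F -> (forall k, cmeasurable (g k)) ->
  {ae haarT3 R, forall t, ctends (fun k => g k t) (F t)} ->
  (forall k, (\int[haarT3 R]_t (cabs (g k t) ^+ 3)%:E <= B%:E)%E) ->
  (\int[haarT3 R]_t (cabs (F t) ^+ 3)%:E <= B%:E)%E.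
Proof.
move=> mF mg gF gB.
have ge0 (H : T3 R -> R[i]) t : (0 <= (cabs (H t) ^+ 3)%:E)%E.
  by rewrite lee_fin exprn_ge0// cabs_ge0.
have mlim : measurable_fun setT (fun t => limn_einf (fun k => (cabs (g k t) ^+ 3)%:E)).
  rewrite (_ : (fun t => _) = (fun t => (- limn_esup (fun k => - (cabs (g k t) ^+ 3)%:E))%E)).
    apply: measurableT_comp => //; apply: measurable_fun_limn_esup => k.
    by apply: measurableT_comp => //; exact: measurable_cabsX.
  by apply/funext => t; rewrite /limn_einf.
apply: (@le_trans _ _ (\int[haarT3 R]_t limn_einf (fun k => (cabs (g k t) ^+ 3)%:E))%E).
  apply: ae_ge0_le_integral => //.
  - exact: measurable_cabsX.
  - move=> t _; rewrite limn_einf_lim; apply: lime_ge; first exact: is_cvg_einfs.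
    by apply: nearW => k; apply: le_ereal_inf_tmp => _ [j _ <-].
  - apply: filterS gF => t gt _.
    have : (fun k => (cabs (g k t) ^+ 3)%:E) @ \oo --> (cabs (F t) ^+ 3)%:E.
      apply: cvg_EFin; first exact: nearW.
      have := ctends_cabs gt => H.
      by under eq_fun do rewrite /= !exprS expr0 mulr1; rewrite !exprS expr0 mulr1;
         apply: cvgM => //; apply: cvgM.
    by move/cvg_limn_einf_sup => [-> _].
apply: le_trans (fatou _ _ _ _) _ => //.
- by move=> k; exact: measurable_cabsX.
- exact: limn_einf_le.
Qed.

(* On a probability space the pointwise inequalities [v <= d + v^3 / d^2] and
   [v^2 <= d^2 + v^3 / d] replace Hoelder's inequality. *)
Lemma integral_cabs_le (F : T3 R -> R[i]) (d B : R) : cmeasurable F -> 0 < d ->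
  (\int[haarT3 R]_t (cabs (F t) ^+ 3)%:E <= B%:E)%E ->
  (\int[haarT3 R]_t (cabs (F t))%:E <= (d + B / d ^+ 2)%:E)%E.
Proof.
move=> mF d0 FB; have mF3 := measurable_cabsX 3 mF.
have d2 : 0 < d ^+ 2 by rewrite exprn_gt0.
apply: (@le_trans _ _ (\int[haarT3 R]_t (d%:E + ((d ^+ 2)^-1)%:E * (cabs (F t) ^+ 3)%:E))%E).
  apply: ge0_le_integral => //.
  - by move=> t _; rewrite lee_fin cabs_ge0.
  - by apply/measurable_EFinP; exact: measurable_cabs.
  - apply: emeasurable_funD => //; apply: emeasurable_funM => //.
  - move=> t _; rewrite -EFinM -EFinD lee_fin; have := cabs_ge0 (F t).
    move: (cabs (F t)) => v v0.
    have [vd|dv] := leP v d.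
      apply: le_trans vd _; rewrite lerDl mulr_ge0 ?exprn_ge0// invr_ge0 ltW//.
    have : v <= (d ^+ 2)^-1 * v ^+ 3.
      rewrite mulrC ler_pdivlMr// (exprS v 2) ler_wpM2l// lerXn2r ?nnegrE// ltW//.
    lra.
rewrite ge0_integralD//; first last.
- by apply: emeasurable_funM.
- by move=> t _; rewrite -EFinM lee_fin mulr_ge0 ?invr_ge0 ?exprn_ge0 ?cabs_ge0 ?ltW.
- by move=> t _; rewrite lee_fin ltW.
rewrite integral_cst// [X in (d%:E * X)%E](_ : _ = 1%E); last exact: haarT3_setT.
rewrite mule1 ge0_integralZl//; first last.
- by rewrite lee_fin invr_ge0 ltW.
- by move=> t _; rewrite lee_fin exprn_ge0// cabs_ge0.
rewrite EFinD; apply: leeD => //; rewrite mulrC EFinM.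
by apply: lee_wpmul2l => //; rewrite lee_fin invr_ge0 ltW.
Qed.

Lemma integral_cabs2_le (F : T3 R -> R[i]) (d B : R) : cmeasurable F -> 0 < d ->
  (\int[haarT3 R]_t (cabs (F t) ^+ 3)%:E <= B%:E)%E ->
  (\int[haarT3 R]_t (cabs (F t) ^+ 2)%:E <= (d ^+ 2 + B / d)%:E)%E.
Proof.
move=> mF d0 FB; have mF3 := measurable_cabsX 3 mF.
have d2 : 0 < d ^+ 2 by rewrite exprn_gt0.
apply: (@le_trans _ _ (\int[haarT3 R]_t ((d ^+ 2)%:E + (d^-1)%:E * (cabs (F t) ^+ 3)%:E))%E).
  apply: ge0_le_integral => //.
  - by move=> t _; rewrite lee_fin exprn_ge0// cabs_ge0.
  - exact: measurable_cabsX.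
  - apply: emeasurable_funD => //; apply: emeasurable_funM => //.
  - move=> t _; rewrite -EFinM -EFinD lee_fin; have := cabs_ge0 (F t).
    move: (cabs (F t)) => v v0.
    have [vd|dv] := leP v d.
      apply: le_trans (_ : d ^+ 2 <= _); first by rewrite lerXn2r ?nnegrE// ltW.
      by rewrite lerDl mulr_ge0 ?exprn_ge0// invr_ge0 ltW.
    have : v ^+ 2 <= d^-1 * v ^+ 3.
      by rewrite mulrC ler_pdivlMr// (exprSr v 2) ler_wpM2l ?exprn_ge0// ltW.
    lra.
rewrite ge0_integralD//; first last.
- by apply: emeasurable_funM.
- by move=> t _; rewrite -EFinM lee_fin mulr_ge0 ?invr_ge0 ?exprn_ge0 ?cabs_ge0 ?ltW.
- by move=> t _; rewrite lee_fin ltW.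
rewrite integral_cst// [X in (_%:E * X)%E](_ : _ = 1%E); last exact: haarT3_setT.
rewrite mule1 ge0_integralZl//; first last.
- by rewrite lee_fin invr_ge0 ltW.
- by move=> t _; rewrite lee_fin exprn_ge0// cabs_ge0.
rewrite EFinD; apply: leeD => //; rewrite mulrC EFinM.
by apply: lee_wpmul2l => //; rewrite lee_fin invr_ge0 ltW.
Qed.

End FatouBound.

Section AlmostEverywhereLimit.
Context {R : realType}.
Local Open Scope classical_set_scope.

Lemma ctends_of_summable (u : nat -> R[i]) :
  ((\sum_(0 <= k <oo) (cabs (u k.+1 - u k))%:E)%E \is a fin_num) ->
  exists z, ctends u z.
Proof.
move=> fin; pose v k : R := cabs (u k.+1 - u k).
have cv : cvgn (series v).
  apply: nondecreasing_is_cvgn.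
    by apply/nondecreasing_seqP => n; rewrite seriesSr lerDl cabs_ge0.
  exists (fine (\sum_(0 <= k <oo) (v k)%:E)%E) => _ [n _ <-].
  rewrite -lee_fin fineK// /series/= -sumEFin.
  by apply: nneseries_lim_ge => k _ _; rewrite lee_fin cabs_ge0.
have lim (f : nat -> R) : (forall k, `|f k.+1 - f k| <= v k) -> cvgn f.
  move=> fv; have ct : cvgn (series (telescope f)).
    apply: normed_cvg; apply: (series_le_cvg _ _ _ cv) => k /=; [exact: normr_ge0|exact: cabs_ge0|exact: fv].
  rewrite (_ : f = (fun n => f 0%N + series (telescope f) n)); last first.
    by apply/funext => n; rewrite -eq_sum_telescope.
  by apply: is_cvgD => //; exact: is_cvg_cst.
have c1 : cvgn (fun k => complex.Re (u k)).
  by apply: lim => k; rewrite -raddfB; exact: ler_Re_cabs.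
have c2 : cvgn (fun k => complex.Im (u k)).
  by apply: lim => k; rewrite -raddfB; exact: ler_Im_cabs.
by exists (Complex (limn (fun k => complex.Re (u k))) (limn (fun k => complex.Im (u k)))).
Qed.

(** The increments have total integral at most 2K, so their sum is finite almost everywhere, and
    there the sequence converges absolutely. *)
Lemma ae_ctends (u : nat -> T3 R -> R[i]) (K : R) : 0 <= K ->
  (forall k, cmeasurable (u k)) ->
  (forall k, (\int[haarT3 R]_t (cabs (u k.+1 t - u k t))%:E <= (K * 2^-1 ^+ k)%:E)%E) ->
  exists F : T3 R -> R[i], cmeasurable F /\
    {ae haarT3 R, forall t, ctends (fun k => u k t) (F t)}.
Proof.
move=> K0 mu uK.
pose v k (t : T3 R) := (cabs (u k.+1 t - u k t))%:E.
have mv k : measurable_fun setT (v k).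
  by apply/measurable_EFinP; apply: measurable_cabs; exact: cmeasurableB.
have v0 k t : (0 <= v k t)%E by rewrite lee_fin cabs_ge0.
(* Upper limits give a measurable function defined everywhere; where they are infinite, [fine]
   replaces them by 0. *)
exists (fun t => Complex (fine (limn_esup (fun k => (complex.Re (u k t))%:E)))
   (fine (limn_esup (fun k => (complex.Im (u k t))%:E)))); split.
  split => /=; (apply: measurableT_comp; first exact: fine_measurable);
    apply: measurable_fun_limn_esup => k; apply/measurable_EFinP;
    by have [] := mu k.
have int : (haarT3 R).-integrable setT (fun t => (\sum_(0 <= k <oo) v k t)%E).
  apply/integrableP; split; first exact: (ge0_emeasurable_sum (P := xpredT)).
  under eq_integral do rewrite gee0_abs ?nneseries_ge0//.
  rewrite integral_nneseries//.
  apply: (@le_lt_trans _ _ (K * 2)%:E); last exact: ltry.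
  apply: lime_le.
    by apply: is_cvg_nneseries => k _ _; apply: integral_ge0.
  apply: nearW => n.
  apply: (@le_trans _ _ (\sum_(0 <= k < n) (K * 2^-1 ^+ k)%:E)%E).
    by apply: lee_sum => k _; exact: uK.
  rewrite sumEFin lee_fin -mulr_sumr ler_wpM2l//.
  suff -> : \sum_(0 <= k < n) 2^-1 ^+ k = 2 - 2 * 2^-1 ^+ n :> R.
    by rewrite gerBl mulr_ge0// exprn_ge0.
  elim: n => [|n IH]; first by rewrite big_geq// expr0 mulr1 subrr.
  by rewrite big_nat_recr//= IH exprS; field.
have := integrable_ae measurableT int; apply: filterS => t /(_ I) fin.
have [z [z1 z2]] := ctends_of_summable fin.
split => /=.
  have /cvg_limn_einf_sup[_ ->] : (fun k => (complex.Re (u k t))%:E) @ \oo --> (complex.Re z)%:E.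
    by apply: cvg_EFin => //; exact: nearW.
  exact: z1.
have /cvg_limn_einf_sup[_ ->] : (fun k => (complex.Im (u k t))%:E) @ \oo --> (complex.Im z)%:E.
  by apply: cvg_EFin => //; exact: nearW.
exact: z2.
Qed.

End AlmostEverywhereLimit.

(** * Square-summable coefficients and the Lambda(3) property *)

Section LambdaParaboloid.
Context {R : realType}.
Variable C : R.
Hypothesis ext : forall B : nat, exists p, [/\ prime p, (B < p)%N &
  forall f : P3_pt p -> R[i], L3norm_Fp3 (extension f) <= C * L2norm_P3 f].
Local Notation G := integer_paraboloid.
Local Open Scope classical_set_scope.

Variable a : G -> R[i].
Hypothesis a_fin : (l2norm a < +oo)%E.

Let esumE := (\esum_(i in [set: G]) (cabs (a i) ^+ 2)%:E)%E.

Let esum_fin : esumE \is a fin_num.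
Proof.
rewrite ge0_fin_numE; last first.
  by apply: esum_ge0 => g _; rewrite lee_fin exprn_ge0// cabs_ge0.
by apply: (@lty_poweRy _ _ 2^-1).
Qed.

Definition l2mass_total : R := fine (\esum_(i in [set: G]) (cabs (a i) ^+ 2)%:E)%E.
Local Notation s := l2mass_total.

Lemma fset_sum_EFin (X : {fset G}) :
  (\sum_(g \in [set` X]) (cabs (a g) ^+ 2)%:E = (fset_mass a X)%:E)%E.
Proof. by rewrite fsbig_finite//= set_fsetK sumEFin. Qed.

Lemma fset_mass_le_total X : fset_mass a X <= s.
Proof.
rewrite -lee_fin fineK//; apply: esum_ge; exists [set` X]; last by rewrite fset_sum_EFin.
by split.
Qed.

Lemma fset_mass_approx e : 0 < e -> exists X : {fset G}, s - e < fset_mass a X.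
Proof.
move=> e0; apply/not_existsP => H.
have : (esumE <= (s - e)%:E)%E.
  apply: ge_ereal_sup => _ [A [finA _] <-].
  have -> : A = [set` fset_set A] by rewrite fset_setK.
  by rewrite fset_sum_EFin lee_fin leNgt; apply/negP; exact: H.
rewrite -(fineK esum_fin) lee_fin -/s; lra.
Qed.

Lemma l2normE : l2norm a = (s `^ 2^-1)%:E.
Proof.
transitivity (s%:E `^ 2^-1)%E; last exact: poweR_EFin.
by congr (_ `^ _)%E; rewrite fineK.
Qed.

(* The tails [4^-k] make the [L^3] distances of consecutive partial sums
   geometric: the cube of the [k]th one is at most [C^3 8^-k]. *)
Lemma mass_chain : exists Y : nat -> {fset G},
  (forall i j, (i <= j)%N -> (Y i `<=` Y j)%fset) /\
  (forall k, s - 4^-1 ^+ k < fset_mass a (Y k)).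
Proof.
have /boolp.choice[X HX] : forall k, exists X : {fset G}, s - 4^-1 ^+ k < fset_mass a X.
  by move=> k; apply: fset_mass_approx; rewrite exprn_gt0.
pose Y := fix Y k := if k is j.+1 then (Y j `|` X j.+1)%fset else X 0%N.
exists Y; split.
  move=> i j; elim: j => [|j IH]; first by rewrite leqn0 => /eqP ->.
  rewrite leq_eqVlt => /orP[/eqP ->//|ij].
  by apply: fsubset_trans (IH ij) _; rewrite /= fsubsetUl.
case=> [|k]; first exact: HX.
by apply: lt_le_trans (HX k.+1) _; apply: fset_mass_le; rewrite /= fsubsetUr.
Qed.

Lemma cmeasurable_fourier_sum X : cmeasurable (fourier_sum a X).
Proof.
apply: cmeasurable_sum => g; apply: cmeasurableM; first exact: cmeasurable_cst.
exact: cmeasurable_character.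
Qed.

Lemma l3bound_quarter k : l3bound C (4^-1 ^+ k) = `|C| ^+ 3 * (2^-1 ^+ k) ^+ 3.
Proof.
rewrite /l3bound; have -> : (4^-1 ^+ k : R) `^ 2^-1 = 2^-1 ^+ k.
  have -> : 4^-1 ^+ k = (2^-1 ^+ k) ^+ 2 :> R.
    rewrite -exprM mulnC exprM; congr (_ ^+ k); rewrite expr2 -invfM; congr (_^-1).
    by rewrite -natrM.
  by rewrite -powR_mulrn ?exprn_ge0// -powRrM mulfV// powRr1// exprn_ge0.
by rewrite exprMn.
Qed.

Lemma Lambda_extend : exists F : T3 R -> R[i],
  [/\ cmeasurable F, fourier_series_is a F &
      (LnormT3 (3 : R) F <= `|C|%:E * l2norm a)%E].
Proof.
have [Y [Ymono Ymass]] := mass_chain.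
pose u k := fourier_sum a (Y k).
have mu k : cmeasurable (u k) by exact: cmeasurable_fourier_sum.
have diff j X X' : (Y j `<=` X)%fset -> (Y j `<=` X')%fset ->
    (\int[haarT3 R]_t (cabs (fourier_sum a X t - fourier_sum a X' t) ^+ 3)%:E <=
     (l3bound C (4^-1 ^+ j))%:E)%E.
  move=> YX YX'; apply: le_trans (fourier_sum_sub_L3_le ext a YX YX') _.
  rewrite lee_fin l3bound_le//.
    by rewrite subr_ge0 fset_mass_le// (fsubset_trans YX)// fsubsetUl.
  have := fset_mass_le_total (X `|` X')%fset; have := Ymass j; lra.
(* In [integral_cabs_le] the choice d = 2^-k balances the two terms: the second is |C|^3 8^-k /
   4^-k, so the L^1 norm of the increment is at most K 2^-k. *)
pose K : R := 1 + `|C| ^+ 3.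
have K0 : 0 <= K by rewrite addr_ge0// exprn_ge0.
have step k : (\int[haarT3 R]_t (cabs (u k.+1 t - u k t))%:E <= (K * 2^-1 ^+ k)%:E)%E.
  have d0 : (0 : R) < 2^-1 ^+ k by rewrite exprn_gt0.
  have H := integral_cabs_le (cmeasurableB (mu k.+1) (mu k)) d0
    (diff k _ _ (Ymono _ _ (leqnSn k)) (fsubset_refl (Y k))).
  apply: le_trans H _; rewrite lee_fin l3bound_quarter /K.
  by rewrite le_eqVlt; apply/orP; left; apply/eqP; field; rewrite gt_eqF.
have [F [mF aeF]] := ae_ctends K0 mu step.
(* X is any finite set above [Y j], not only a member of the chain, since the Fourier series is a
   limit over all finite sets. The shift by j keeps the approximating sets above [Y j]. *)
have close j X : (Y j `<=` X)%fset ->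
    (\int[haarT3 R]_t (cabs (F t - fourier_sum a X t) ^+ 3)%:E <=
     (l3bound C (4^-1 ^+ j))%:E)%E.
  move=> YX; apply: (@fatou_cabs3 _ (fun k t => u (k + j)%N t - fourier_sum a X t)).
  - by apply: cmeasurableB => //; exact: cmeasurable_fourier_sum.
  - by move=> k; apply: cmeasurableB => //; exact: cmeasurable_fourier_sum.
  - by apply: filterS aeF => t /(@ctends_shift _ _ _ j) /ctends_sub; apply.
  - by move=> k; apply: diff => //; apply: Ymono; rewrite leq_addl.
exists F; split=> //.
  move=> e e0.
  (* As m <= 2^m <= 8^m, this makes the bound |C|^3 8^-m at most e^3/8. *)
  have [m Hm] := nat_above (8 * `|C| ^+ 3 / e ^+ 3).
  have e3 : 0 < e ^+ 3 by rewrite exprn_gt0.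
  exists (Y m) => X YX.
  (* With d = e/2 both terms are at most e^2/4; their sum e^2/2 leaves room for the strict
     inequality. *)
  have H := integral_cabs2_le (d := e / 2) (cmeasurableB mF (cmeasurable_fourier_sum X))
    (divr_gt0 e0 (ltr0Sn _ _)) (close m X YX).
  rewrite (LnormT3E 1).
  apply: (@le_lt_trans _ _ ((e ^+ 2 / 2)%:E `^ 2^-1))%E.
    apply: gt0_ler_poweR => //.
    - by rewrite in_itv/= andbC leey//=; apply: integral_ge0 => t _; rewrite lee_fin exprn_ge0// cabs_ge0.
    - by rewrite in_itv/= andbC leey//= lee_fin divr_ge0// exprn_ge0// ltW.
    apply: le_trans H _; rewrite lee_fin l3bound_quarter.
    have small : `|C| ^+ 3 * (2^-1 ^+ m) ^+ 3 <= e ^+ 3 / 8.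
      have m2 : (m%:R : R) <= 2 ^+ m by rewrite -natrX ler_nat ltnW// ltn_expl.
      have p1 : (1 : R) <= 2 ^+ m by rewrite exprn_ege1// ler1n.
      have p0 : (0 : R) < 2 ^+ m by rewrite exprn_gt0.
      have q : (m%:R : R) <= (2 ^+ m) ^+ 3.
        apply: le_trans m2 _; rewrite -[leLHS]expr1 ler_weXn2l//.
      have -> : (2^-1 ^+ m) ^+ 3 = ((2 ^+ m) ^+ 3)^-1 :> R by rewrite !exprVn.
      rewrite ler_pdivrMr ?exprn_gt0//.
      move: Hm; rewrite ler_pdivrMr// => Hm.
      rewrite mulrAC ler_pdivlMr// mulrC; apply: le_trans Hm _.
      by rewrite mulrC ler_pM2l.
    have : `|C| ^+ 3 * (2^-1 ^+ m) ^+ 3 / (e / 2) <= e ^+ 2 / 4.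
      rewrite ler_pdivrMr ?divr_gt0//; apply: le_trans small _.
      by rewrite le_eqVlt; apply/orP; left; apply/eqP; field.
    have -> : (e / 2) ^+ 2 = e ^+ 2 / 4 by field.
    have -> : e ^+ 2 / 2 = e ^+ 2 / 4 + e ^+ 2 / 4 by field.
    by move=> ?; rewrite lerD2l.
  rewrite poweR_EFin lte_fin.
  have Ee : e = (e ^+ 2) `^ 2^-1.
    by rewrite -powR_mulrn ?(ltW e0)// -powRrM mulfV// powRr1// ltW.
  rewrite [ltRHS]Ee gt0_ltr_powR ?nnegrE ?divr_ge0 ?exprn_ge0 ?(ltW e0)//.
  by rewrite ltr_pdivrMr// ltr_pMr ?exprn_gt0// ltr1n.
rewrite l2normE -EFinM.
apply: LnormT3_3_le; apply: (@fatou_cabs3 _ u) => // k.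
apply: le_trans (fourier_sum_L3_le ext a (Y k)) _; rewrite lee_fin.
by apply: l3bound_le; [exact: fset_mass_ge0|exact: fset_mass_le_total].
Qed.

End LambdaParaboloid.

Unset Implicit Arguments.
Set Strict Implicit.

Theorem mainTheorem3 (R : realType) (a : int) (M : nat) (M_gt0 : (0 < M)%N)
  (coprime_aM : coprimez a M%:Z)
  (nonsquare : forall p : nat, prime p -> (p%:Z = a %[mod M%:Z])%Z ->
     ~ exists x : 'F_p, x ^+ 2 = -1)
  (extension_bound : exists (C : R) (p0 : nat), forall p : nat,
     prime p -> (p0 <= p)%N -> (p%:Z = a %[mod M%:Z])%Z ->
     forall f : P3_pt p -> R[i],
       L3norm_Fp3 (extension f) <= C * L2norm_P3 f) :
  (exists C' : R, forall (S : {fset int * int}) (c : S -> R[i]),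
     (LnormT3 3%R (fun t : T3 R =>
        \sum_(n : S) c n * character (lift_paraboloid (\val n)) t)%R
      <= (C' * (\sum_(n : S) cabs (c n) ^+ 2) `^ 2^-1)%R%:E)%E) /\
  Lambda_set (3 : R) integer_paraboloid.
Proof.
case: extension_bound => C [p0 H].
have ext B : exists p, [/\ prime p, (B < p)%N &
    forall f : P3_pt p -> R[i], L3norm_Fp3 (extension f) <= C * L2norm_P3 f].
  (* A prime above B + p0 exceeds B and lies in the range of the extension hypothesis. *)
  have [p [pp Bp pa]] := dirichlet_primes_int R (B + p0) M_gt0 coprime_aM.
  exists p; split=> //; first by apply: leq_ltn_trans Bp; exact: leq_addr.
  by apply: H => //; apply: ltnW; apply: leq_ltn_trans Bp; exact: leq_addl.
split; exists `|C|; first by move=> S c; exact: finite_sum_L3.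
by move=> c; exact: Lambda_extend.
Qed.
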